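(* Let $X$ be a real Banach space and let $T:X\to X$ be an $M$-amenable operator for a special cone $K\subset X$. Then there is $\delta_T>0$ such that $F=T-P:X\to X$ is a fold for every $C^1$ map $P:X\to X$ which is $M$-compatible with $T$ and satisfies $\|DP(u)-r(T)\,I\|<\delta_T$ for all $u\in X$.
   Context: Folds. A continuous function $F:X\to Y$ between real Banach spaces is a fold if there are a Banach space $W$ and homeomorphisms $\zeta:X\to W\oplus\mathbb{R}$ and $\xi:Y\to W\oplus\mathbb{R}$ such that $\xi\circ F\circ\zeta^{-1}(w,t)=(w,-|t|)$ for all $(w,t)$. Cones. A cone $K\subset X$ is a closed set with $0\in K$, $K+K\subset K$, $tK\subset K$ for $t\ge0$, and such that $v,-v\in K$ implies $v=0$. It is solid if its interior $\mathring K$ is nonempty, and generating if $K-K=X$. Its dual is $K^*=\{v^*\in X^*: \langle v^*,v\rangle\ge0 \ \forall v\in K\}$. A solid cone $K$ is special if $K\subset X$ and $K^*\subset X^*$ are both generating. An operator $S\in\mathcal{B}(X)$ (bounded linear operators on $X$, operator norm) is positive with respect to $K$ if $SK\subset K$, and strongly positive if $S(K\setminus\{0\})\subset\mathring K$. Elementary eigenvalues. Spaces are complexified for spectral theory. An eigenvalue $\lambda\in\sigma(T)$ is elementary if it is an isolated point of $\sigma(T)$ and the invariant subspace of $T$ associated with $\{\lambda\}$ (range of the Dunford-Schwartz spectral projection) is spanned by an eigenvector, i.e. $\lambda$ has algebraic multiplicity one. $M$-amenable operators. Let $r(T)$ be the spectral radius of $T\in\mathcal{B}(X)$. $T$ is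 $M$-amenable for a special cone $K$ if: (M-a) $r(T)$ is an elementary eigenvalue of $T$; (M-b) for some $p\ge0$, $(T+pI)(K\setminus\{0\})\subset\mathring K$. Notation. Write $r=\lambda_M=r(T)$, let $\phi_M\in\mathring K$ be an associated eigenvector, $V$ its span, $W_X=\operatorname{Ran}(T-rI)$, so that $X=W_X\oplus V$, and let $\Pi:X\to W_X$ be the projection onto $W_X$ along $V$. The restriction $T_{r,W}=T-rI:W_X\to W_X$ is invertible. Let $\phi_M^*\in X^*$ be the functional vanishing on $\operatorname{Ran}(T-rI)$ with $\langle\phi_M^*,\phi_M\rangle=1$. For a map $P:X\to X$ set $P_r=P-rI$. $M$-compatible maps. A $C^1$ map $P:X\to X$ is $M$-compatible with $T$ if: (M-AC) $\Pi P_r:X\to W_X$ is Lipschitz with a constant $L$ satisfying $L\|T_{r,W}^{-1}\|<1$. (M-PR) There exist $\lambda_-,\lambda_+,c_-,c_+\in\mathbb{R}$ with $\lambda_-<r<\lambda_+$ such that for all $u\in X$ both $\langle\phi_M^*,P_r(u)\rangle\ge(\lambda_--r)\langle\phi_M^*,u\rangle+c_-$ and $\langle\phi_M^*,P_r(u)\rangle\ge(\lambda_+-r)\langle\phi_M^*,u\rangle+c_+$. (M-Pos) For some $p>0$ and every $u\in X$, $pI-DP(u)$ is positive with respect to $K$. (M-NT) If $z-y\in\mathring K$, then $DP(z)-DP(y)$ is strongly positive with respect to $K$. *)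

(* Defs.v *)
(* Real Banach spaces are Coquelicot's complete normed modules
   over R, and bounded linear maps are those satisfying Coquelicot's
   [is_linear] (linear, with a bound norm (l x) <= M * norm x). *)
From Stdlib Require Import Reals.
From Coquelicot Require Import Coquelicot.
Open Scope R_scope.

Notation Banach := (CompleteNormedModule R_AbsRing).

(** * Operators *)

Definition shift {X : Banach} (A : X -> X) (a : R) : X -> X :=
  fun x => plus (A x) (scal a x).

Definition diff_map {X : Banach} (A B : X -> X) : X -> X :=
  fun x => minus (A x) (B x).

(* The supremum of [norm (A x)] over the unit ball of the subspace [W]; it is
   meaningful only if [A] is bounded on [W], since [real] sends an infinite
   supremum to 0. *)
Definition opnorm_on {X : Banach} (W : X -> Prop) (A : X -> X) : R :=
  real (Lub_Rbar (fun c => exists x, W x /\ norm x <= 1 /\ c = norm (A x))).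

Definition opnorm {X : Banach} (A : X -> X) : R := opnorm_on (fun _ => True) A.

(** * Folds *)

Definition homeomorphism {U V : UniformSpace} (f : U -> V) (g : V -> U) : Prop :=
  (forall x, continuous f x) /\ (forall y, continuous g y) /\
  (forall x, g (f x) = x) /\ (forall y, f (g y) = y).

Definition sum_R (W : Banach) : NormedModule R_AbsRing :=
  prod_NormedModule R_AbsRing W R_NormedModule.

Definition fold {X Y : Banach} (F : X -> Y) : Prop :=
  (forall x, continuous F x) /\
  exists (W : Banach)
         (zeta : X -> sum_R W) (zeta_inv : sum_R W -> X)
         (xi : Y -> sum_R W) (xi_inv : sum_R W -> Y),
    homeomorphism zeta zeta_inv /\
    homeomorphism xi xi_inv /\
    forall (w : W) (t : R), xi (F (zeta_inv (w, t))) = (w, - Rabs t).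

(** * Cones *)

Definition interior {X : Banach} (K : X -> Prop) : X -> Prop :=
  fun x => locally x K.

Record cone {X : Banach} (K : X -> Prop) : Prop := {
  cone_closed : closed K;
  cone_zero : K zero;
  cone_plus : forall u v, K u -> K v -> K (plus u v);
  cone_scal : forall (t : R) v, 0 <= t -> K v -> K (scal t v);
  cone_pointed : forall v, K v -> K (opp v) -> v = zero }.

Definition solid {X : Banach} (K : X -> Prop) : Prop := exists x, interior K x.

Definition generating {X : Banach} (K : X -> Prop) : Prop :=
  forall x, exists a b, K a /\ K b /\ x = minus a b.

Definition functional {X : Banach} (f : X -> R) : Prop :=
  is_linear (K := R_AbsRing) (U := X) (V := R_NormedModule) f.

Definition dual_cone {X : Banach} (K : X -> Prop) (f : X -> R) : Prop :=
  functional f /\ forall v, K v -> 0 <= f v.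

Definition dual_generating {X : Banach} (K : X -> Prop) : Prop :=
  forall f : X -> R, functional f ->
  exists a b, dual_cone K a /\ dual_cone K b /\ forall x, f x = a x - b x.

Definition special_cone {X : Banach} (K : X -> Prop) : Prop :=
  cone K /\ solid K /\ generating K /\ dual_generating K.

Definition positive_op {X : Banach} (K : X -> Prop) (S : X -> X) : Prop :=
  forall v, K v -> K (S v).

Definition strongly_positive {X : Banach} (K : X -> Prop) (S : X -> X) : Prop :=
  forall v, K v -> v <> zero -> interior K (S v).

(** * Spectral theory on the complexification *)

(* The pair (x, y) stands for x + i y.  The product norm is equivalent to any
   of the usual complex norms, and only the topology is used below. *)
Definition cplx (X : Banach) : NormedModule R_AbsRing :=
  prod_NormedModule R_AbsRing X X.

Definition cscal {X : Banach} (z : C) (p : cplx X) : cplx X :=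
  (minus (scal (fst z) (fst p)) (scal (snd z) (snd p)),
   plus (scal (fst z) (snd p)) (scal (snd z) (fst p))).

Definition cext {X : Banach} (T : X -> X) (p : cplx X) : cplx X :=
  (T (fst p), T (snd p)).

(* [Q] is the bounded inverse of z I - T.  Only real linearity is required of
   [Q]: complex linearity follows, since z I - T is complex linear. *)
Definition is_resolvent {X : Banach} (T : X -> X) (z : C)
    (Q : cplx X -> cplx X) : Prop :=
  is_linear Q /\
  (forall p, minus (cscal z (Q p)) (cext T (Q p)) = p) /\
  (forall p, Q (minus (cscal z p) (cext T p)) = p).

Definition spectrum {X : Banach} (T : X -> X) (z : C) : Prop :=
  ~ exists Q, is_resolvent T z Q.

Definition spectral_radius {X : Banach} (T : X -> X) : R :=
  real (Lub_Rbar (fun m => exists z, spectrum T z /\ m = Cmod z)).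

Definition isolated_in_spectrum {X : Banach} (T : X -> X) (l : C) : Prop :=
  spectrum T l /\
  exists eps, 0 < eps /\
    forall z, spectrum T z -> Cmod (Cminus z l) < eps -> z = l.

Definition eigenvector {X : Banach} (T : X -> X) (l : C) (v : cplx X) : Prop :=
  v <> zero /\ cext T v = cscal l v.

Definition circle (l : C) (rho theta : R) : C :=
  Cplus l (Cmult (RtoC rho) (cos theta, sin theta)).

Definition circle_deriv (rho theta : R) : C :=
  Cmult Ci (Cmult (RtoC rho) (cos theta, sin theta)).

(* The Dunford-Schwartz projection for {l}: E is, pointwise, the contour
   integral (2 pi i)^-1 \oint (z I - T)^-1 dz over a positively oriented circle
   around l whose closed disc meets the spectrum at most at l. *)
Definition is_spectral_projection {X : Banach} (T : X -> X) (l : C)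
    (E : cplx X -> cplx X) : Prop :=
  exists (rho : R) (Res : C -> cplx X -> cplx X),
    0 < rho /\
    (forall z, spectrum T z -> Cmod (Cminus z l) <= rho -> z = l) /\
    (forall z, Cmod (Cminus z l) = rho -> is_resolvent T z (Res z)) /\
    forall p,
      is_RInt
        (fun theta =>
           cscal (Cmult (Cinv (Cmult (RtoC (2 * PI)) Ci)) (circle_deriv rho theta))
                 (Res (circle l rho theta) p))
        0 (2 * PI) (E p).

Definition elementary_eigenvalue {X : Banach} (T : X -> X) (l : C) : Prop :=
  isolated_in_spectrum T l /\
  exists (E : cplx X -> cplx X) (v : cplx X),
    is_spectral_projection T l E /\
    eigenvector T l v /\
    forall q, (exists p, q = E p) <-> (exists c : C, q = cscal c v).

(** * M-amenable operators *)

Record M_amenable {X : Banach} (K : X -> Prop) (T : X -> X) : Prop := {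
  M_bounded : is_linear T;
  M_a : elementary_eigenvalue T (RtoC (spectral_radius T));
  M_b : exists p, 0 <= p /\ strongly_positive K (shift T p) }.

(** * M-compatible maps *)

(* T - r I, with r = r(T). *)
Definition T_r {X : Banach} (T : X -> X) : X -> X :=
  shift T (- spectral_radius T).

Definition W_X {X : Banach} (T : X -> X) (w : X) : Prop :=
  exists x, w = T_r T x.

(* [phi] is phi_M, [phis] is phi_M^*, [Pi] is the projection onto W_X along the
   span of phi_M, and [S], whose values outside W_X are irrelevant, is the
   inverse of the restriction T_{r,W} of T - r I to W_X. *)
Record M_splitting {X : Banach} (K : X -> Prop) (T : X -> X)
    (phi : X) (phis : X -> R) (Pi S : X -> X) : Prop := {
  phi_interior : interior K phi;
  phi_eigen : T phi = scal (spectral_radius T) phi;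
  phis_functional : functional phis;
  phis_W : forall w, W_X T w -> phis w = 0;
  phis_phi : phis phi = 1;
  Pi_W : forall u, W_X T (Pi u);
  Pi_along : forall u, exists c : R, minus u (Pi u) = scal c phi;
  S_W : forall w, W_X T w -> W_X T (S w);
  S_right : forall w, W_X T w -> T_r T (S w) = w;
  S_left : forall w, W_X T w -> S (T_r T w) = w }.

Definition is_C1 {X : Banach} (P : X -> X) (DP : X -> X -> X) : Prop :=
  (forall u, filterdiff P (locally u) (DP u)) /\
  forall u eps, 0 < eps ->
    locally u (fun v => opnorm (diff_map (DP v) (DP u)) < eps).

Definition M_AC {X : Banach} (T : X -> X) (Pi S P : X -> X) : Prop :=
  let r := spectral_radius T in
  exists L, 0 <= L /\
    (forall u v,
       norm (minus (Pi (shift P (- r) u)) (Pi (shift P (- r) v)))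
         <= L * norm (minus u v)) /\
    L * opnorm_on (W_X T) S < 1.

Definition M_PR {X : Banach} (T : X -> X) (phis : X -> R) (P : X -> X) : Prop :=
  let r := spectral_radius T in
  exists lm lp cm cp, lm < r < lp /\
    forall u,
      phis (shift P (- r) u) >= (lm - r) * phis u + cm /\
      phis (shift P (- r) u) >= (lp - r) * phis u + cp.

Definition M_Pos {X : Banach} (K : X -> Prop) (DP : X -> X -> X) : Prop :=
  exists p, 0 < p /\
    forall u, positive_op K (fun v => minus (scal p v) (DP u v)).

Definition M_NT {X : Banach} (K : X -> Prop) (DP : X -> X -> X) : Prop :=
  forall z y, interior K (minus z y) ->
    strongly_positive K (diff_map (DP z) (DP y)).

(* For an M-amenable T, phi_M exists and is unique up to a positive factor, and
   it determines the other data (S on W_X only).  Rescaling phi_M leaves (M-AC)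
   unchanged and only rescales c_- and c_+ in (M-PR), so the conditions do not
   depend on the choice of phi_M; the existence of the data is not assumed. *)
Record M_compatible {X : Banach} (K : X -> Prop) (T : X -> X)
    (P : X -> X) (DP : X -> X -> X) : Prop := {
  M_comp_C1 : is_C1 P DP;
  M_comp_AC : forall phi phis Pi S,
    M_splitting K T phi phis Pi S -> M_AC T Pi S P;
  M_comp_PR : forall phi phis Pi S,
    M_splitting K T phi phis Pi S -> M_PR T phis P;
  M_comp_Pos : M_Pos K DP;
  M_comp_NT : M_NT K DP }.

(* Main.v *)
(* Put r = r(T).  The contour integrals of (z - T)^-1 and (z - T)^-1 / (z - r)
   give the spectral projection x |-> f(x) phi and a bounded partial inverse G
   of T - r.  For real l > r the resolvent (l - T)^-1 preserves K (by
   continuation from large l), and (l - r) (l - T)^-1 tends to the projection as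
   l decreases to r; hence f >= 0 on K and phi can be taken in the interior.

   Write P_r = P - r.  For small delta the map u |-> u - Pi G P_r(u) is a
   homeomorphism Psi of X, and F (Psi^-1 y) = (T - r) y - f (P_r (Psi^-1 y)) phi.
   On each fibre y = w + t phi, with w in the kernel of f, only the height
   h(t) = - f (P_r (Psi^-1 y)) remains.  For t1 < t2 < t3 the chords of the
   fibre are interior to K, and comparing the averages of DF = T - DP over two
   consecutive chords shows that h(t2) <= h(t1) forces h(t3) < h(t2).  So h is
   strictly unimodal, and by (M-PR) it tends to - oo at both ends; straightening
   h turns F into (w, t) |-> (w, -|t|). *)
From Stdlib Require Import Reals Lra Lia List Classical ClassicalEpsilon ProofIrrelevance.
From Coquelicot Require Import Coquelicot.
(* Last, so that [interior] is that of the definitions and not of Stdlib. *)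
Require Import Defs.
Import ListNotations.
Open Scope R_scope.

(** * Linear identities in a real vector space *)

(** Classically the shape of h comes from the sign of the principal eigenvalue of DF along a fibre,
    which calls for perturbation theory of that eigenvalue. Two consecutive chords require only mean
    value integrals: (M-NT) compares the two averages of DP, and the strong positivity of T + p
    takes the place of the eigenvector. Strictness of the resulting inequality gives both uniqueness
    of the maximum on a fibre and its continuous dependence on w. The chords are interior because
    Psi^-1 turns a step along phi into a step in a direction close to phi, and phi has a ball around
    it in K. The size of that ball, the norm of phi and a bound for Pi G depend on T alone and fix
    delta. Pi G takes its values in the kernel of f, so Psi preserves f. The height t of y is
    therefore also f(Psi^-1 y), and (M-PR), which is stated through f(u), bounds h on every fibre by
    the same two affine functions. The spectral radius is a supremum over the spectrum, so near r
    there is no convergent iteration at hand to show that the resolvent preserves K. Positivity is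
    carried leftwards in steps whose length is governed by the norm of the resolvent. *)

Inductive vexpr :=
  | VAtom (n : nat) | VZero | VPlus (a b : vexpr) | VOpp (a : vexpr)
  | VMinus (a b : vexpr) | VScal (k : R) (a : vexpr).

Fixpoint veval {V : NormedModule R_AbsRing} (env : list V) (e : vexpr) : V :=
  match e with
  | VAtom n => nth n env zero
  | VZero => zero
  | VPlus a b => plus (veval env a) (veval env b)
  | VOpp a => opp (veval env a)
  | VMinus a b => minus (veval env a) (veval env b)
  | VScal k a => scal k (veval env a)
  end.

Fixpoint vcoef (e : vexpr) (m : nat) : R :=
  match e with
  | VAtom n => if Nat.eqb n m then 1 else 0
  | VZero => 0
  | VPlus a b => vcoef a m + vcoef b m
  | VOpp a => - vcoef a m
  | VMinus a b => vcoef a m - vcoef b m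
  | VScal k a => k * vcoef a m
  end.

Fixpoint lin_comb {V : NormedModule R_AbsRing} (env : list V) (c : nat -> R) : V :=
  match env with
  | [] => zero
  | x :: env' => plus (scal (c 0%nat) x) (lin_comb env' (fun m => c (S m)))
  end.

(** A conjunction over the listed atoms only, so that [cbn] unfolds it into finitely many identities
    in R. *)
Fixpoint same_coefs (n : nat) (c d : nat -> R) : Prop :=
  match n with
  | 0%nat => True
  | S n' => c 0%nat = d 0%nat /\ same_coefs n' (fun m => c (S m)) (fun m => d (S m))
  end.

Lemma minus_as_scal (V : NormedModule R_AbsRing) (a b : V) :
  minus a b = plus a (scal (-1) b).
Proof. unfold minus; f_equal; symmetry; exact (scal_opp_one b). Qed.

(** One identity serves every compound constructor in [veval_coef]: [k = 1] and [k = -1] give sums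
    and differences, [c = 0] gives multiples and opposites. *)
Lemma lin_comb_scal_plus (V : NormedModule R_AbsRing) (env : list V) (k : R) c d :
  lin_comb env (fun m => c m + k * d m) = plus (lin_comb env c) (scal k (lin_comb env d)).
Proof.
  revert c d; induction env as [|x env IH]; intros c d; simpl.
  - symmetry; etransitivity; [exact (plus_zero_l _)|exact (scal_zero_r k)].
  - rewrite (IH (fun m => c (S m)) (fun m => d (S m))).
    etransitivity; [apply f_equal2; [exact (scal_distr_r (c 0%nat) (k * d 0%nat) x)|reflexivity]|].
    symmetry; etransitivity;
      [apply f_equal2; [reflexivity|exact (scal_distr_l k (scal (d 0%nat) x) _)]|].
    rewrite <- !plus_assoc; f_equal; rewrite !plus_assoc; f_equal.
    etransitivity; [apply plus_comm|f_equal; exact (scal_assoc k (d 0%nat) x)].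
Qed.

Lemma lin_comb_ext (V : NormedModule R_AbsRing) (env : list V) c d :
  same_coefs (length env) c d -> lin_comb env c = lin_comb env d.
Proof.
  revert c d; induction env as [|x env IH]; intros c d; simpl; [easy|].
  intros [-> H]; f_equal; auto.
Qed.

Lemma same_coefs_all (n : nat) (c d : nat -> R) :
  (forall m, c m = d m) -> same_coefs n c d.
Proof. revert c d; induction n; simpl; intros; auto. Qed.

Lemma lin_comb_zero (V : NormedModule R_AbsRing) (env : list V) :
  lin_comb env (fun _ => 0) = zero.
Proof.
  induction env as [|x env IH]; simpl; [easy|].
  rewrite IH, plus_zero_r; exact (scal_zero_l x).
Qed.

Lemma veval_coef (V : NormedModule R_AbsRing) (env : list V) (e : vexpr) :
  veval env e = lin_comb env (vcoef e).
Proof.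
  assert (Z : forall c : nat -> R, lin_comb env (fun m => 0 + 1 * c m) = lin_comb env c).
  { intros c; apply lin_comb_ext, same_coefs_all; intros; ring. }
  induction e as [n| |a IHa b IHb|a IHa|a IHa b IHb|k a IHa]; simpl.
  - revert n; induction env as [|x env IH]; intros [|n]; simpl; try easy.
    + rewrite lin_comb_zero, plus_zero_r; symmetry; exact (scal_one x).
    + clear Z IH. transitivity (lin_comb env (fun m => if Nat.eqb n m then 1 else 0)).
      * revert n; induction env as [|y env IH]; intros [|n]; simpl; try easy.
        -- rewrite lin_comb_zero, plus_zero_r; symmetry; exact (scal_one y).
        -- rewrite <- IH. symmetry; etransitivity; [apply f_equal2; [exact (scal_zero_l y)|reflexivity]|].
           apply plus_zero_l.
      * symmetry; etransitivity; [apply f_equal2; [exact (scal_zero_l x)|reflexivity]|].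
        apply plus_zero_l.
  - symmetry; apply lin_comb_zero.
  - rewrite IHa, IHb. transitivity (lin_comb env (fun m => vcoef a m + 1 * vcoef b m)).
    + rewrite lin_comb_scal_plus; f_equal; symmetry; exact (scal_one _).
    + apply lin_comb_ext, same_coefs_all; intros; ring.
  - rewrite IHa; transitivity (scal (-1) (lin_comb env (vcoef a))).
    { symmetry; exact (scal_opp_one _). }
    transitivity (lin_comb env (fun m => (fun _ => 0) m + (-1) * vcoef a m)).
    + rewrite lin_comb_scal_plus, lin_comb_zero, plus_zero_l; reflexivity.
    + apply lin_comb_ext, same_coefs_all; intros; ring.
  - rewrite IHa, IHb, minus_as_scal, <- lin_comb_scal_plus.
    apply lin_comb_ext, same_coefs_all; intros; ring.
  - rewrite IHa. transitivity (lin_comb env (fun m => (fun _ => 0) m + k * vcoef a m)).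
    + rewrite lin_comb_scal_plus, lin_comb_zero, plus_zero_l; reflexivity.
    + apply lin_comb_ext, same_coefs_all; intros; ring.
Qed.

Lemma veval_eq (V : NormedModule R_AbsRing) (env : list V) (e1 e2 : vexpr) :
  same_coefs (length env) (vcoef e1) (vcoef e2) -> veval env e1 = veval env e2.
Proof. intros H; rewrite !veval_coef; now apply lin_comb_ext. Qed.

Ltac v_mem x l :=
  lazymatch l with
  | nil => constr:(false)
  | x :: _ => constr:(true)
  | _ :: ?l' => v_mem x l'
  end.
Ltac v_index x l :=
  lazymatch l with
  | x :: _ => constr:(0%nat)
  | _ :: ?l' => let n := v_index x l' in constr:(S n)
  end.
Ltac v_atoms t l :=
  lazymatch t with
  | @plus _ ?a ?b => let l := v_atoms a l in v_atoms b l
  | @minus _ ?a ?b => let l := v_atoms a l in v_atoms b l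
  | @opp _ ?a => v_atoms a l
  | @scal _ _ _ ?a => v_atoms a l
  | @zero _ => l
  | _ => lazymatch v_mem t l with true => l | false => constr:(t :: l) end
  end.
Ltac v_reify t l :=
  lazymatch t with
  | @plus _ ?a ?b => let a := v_reify a l in let b := v_reify b l in constr:(VPlus a b)
  | @minus _ ?a ?b => let a := v_reify a l in let b := v_reify b l in constr:(VMinus a b)
  | @opp _ ?a => let a := v_reify a l in constr:(VOpp a)
  | @scal _ _ ?k ?a => let a := v_reify a l in constr:(VScal k a)
  | @zero _ => constr:(VZero)
  | _ => let n := v_index t l in constr:(VAtom n)
  end.
(* Reduces an identity between linear combinations in [V] to the identities
   between the coefficients. *)
Ltac vec_eq V :=
  lazymatch goal with
  | |- @eq _ ?a ?b =>
    let l := v_atoms a (@nil V) in let l := v_atoms b l in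
    let ea := v_reify a l in let eb := v_reify b l in
    change (@veval V l ea = @veval V l eb); apply veval_eq;
    cbn [same_coefs length vcoef Nat.eqb]; repeat split
  end.
Ltac vec V := vec_eq V; try ring.
(* [replace] may miss a norm whose argument is typed through another path of
   the structure hierarchy, so the occurrence is taken from the goal. *)
Ltac norm_as V b :=
  match goal with
  | |- context [@norm ?K ?W ?a] =>
    replace (@norm K W a) with (@norm K W b)
      by (apply (f_equal (@norm K W)); solve [vec V | vec_eq V; field; lra])
  end.

(** * Normed spaces *)

Section Norms.
Context {V : NormedModule R_AbsRing}.

Lemma locally_norm_iff (x : V) (P : V -> Prop) :
  locally x P <-> exists eps, 0 < eps /\ forall y, norm (minus y x) < eps -> P y.
Proof.
  split.
  - intros H; apply (locally_norm_le_locally x P) in H; destruct H as [e He].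
    exists e; split; [apply cond_pos|]; intros y Hy; now apply He.
  - intros (e & He & H); apply (locally_le_locally_norm x P); exists (mkposreal e He).
    intros y Hy; now apply H.
Qed.

Lemma norm_nonneg (x : V) : 0 <= norm x.
Proof. apply @norm_ge_0. Qed.

Lemma norm_minus_sym (x y : V) : norm (minus x y) = norm (minus y x).
Proof. rewrite <- norm_opp; f_equal; vec V. Qed.

Lemma norm_minus_triangle (x y : V) : norm (minus x y) <= norm x + norm y.
Proof. rewrite <- (norm_opp y); unfold minus; apply @norm_triangle. Qed.

Lemma norm_minus_diag (x : V) : norm (minus x x) = 0.
Proof. replace (minus x x) with (zero : V) by vec V; apply @norm_zero. Qed.

Lemma norm_chain (x y z : V) : norm (minus x z) <= norm (minus x y) + norm (minus y z).
Proof.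
  replace (minus x z) with (plus (minus x y) (minus y z)) by vec V; apply @norm_triangle.
Qed.

(** [norm_scal] is only an inequality; applied to [/ k] it gives the converse. *)
Lemma norm_scal_eq (k : R) (x : V) : norm (scal k x) = Rabs k * norm x.
Proof.
  destruct (Req_dec k 0) as [->|Hk].
  { replace (scal 0 x) with (zero : V) by vec V; rewrite norm_zero, Rabs_R0; ring. }
  apply Rle_antisym; [exact (norm_scal k x)|].
  apply Rmult_le_reg_l with (/ Rabs k); [apply Rinv_0_lt_compat, Rabs_pos_lt, Hk|].
  rewrite <- Rmult_assoc, Rinv_l, Rmult_1_l by now apply Rabs_no_R0.
  rewrite <- Rabs_inv; replace x with (scal (/ k) (scal k x)) at 1 by (vec_eq V; now field).
  exact (norm_scal (/ k) (scal k x)).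
Qed.

Lemma minus_eq_zero (x y : V) : minus x y = zero -> x = y.
Proof.
  intros H; replace x with (plus (minus x y) y) by vec V; rewrite H; vec V.
Qed.

Lemma norm_minus_0 (x y : V) : norm (minus x y) <= 0 -> x = y.
Proof.
  intros H; apply minus_eq_zero, @norm_eq_zero; generalize (norm_nonneg (minus x y)); lra.
Qed.

Lemma norm_minus_eps (x y : V) : (forall eps, 0 < eps -> norm (minus x y) <= eps) -> x = y.
Proof.
  intros H; apply norm_minus_0.
  destruct (Rle_or_lt (norm (minus x y)) 0); [easy|].
  specialize (H (norm (minus x y) / 2)); lra.
Qed.

Lemma closed_approx (D : V -> Prop) (x : V) :
  closed D -> (forall eps, 0 < eps -> exists y, D y /\ norm (minus y x) < eps) -> D x.
Proof.
  intros HD H; apply HD; intros HL; apply locally_norm_iff in HL.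
  destruct HL as (e & He & HL); destruct (H e He) as (y & Hy & Hn); exact (HL y Hn Hy).
Qed.

(** Stated for normed modules because [cplx X] is declared only as a [NormedModule], and the fixed
    point theorem is applied there too. *)
Definition seq_complete : Prop := forall u : nat -> V,
  (forall eps, 0 < eps -> exists N, forall m n, (N <= m)%nat -> (N <= n)%nat ->
     norm (minus (u m) (u n)) < eps) ->
  exists l, forall eps, 0 < eps -> exists N, forall n, (N <= n)%nat ->
     norm (minus (u n) l) < eps.

(* The iterates stay within [norm (f x0 - x0) / (1 - c)] of [x0]; applying this
   after [n] steps gives the Cauchy property. *)
Lemma contraction_fixed_point (Hc : seq_complete) (f : V -> V) (c : R) (D : V -> Prop) (x0 : V) :
  0 <= c < 1 -> (forall x y, norm (minus (f x) (f y)) <= c * norm (minus x y)) ->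
  closed D -> D x0 -> (forall x, D x -> D (f x)) ->
  exists x, D x /\ f x = x.
Proof.
  intros Hc1 Hf HD H0 HDf.
  set (u := fun n => Nat.iter n f x0).
  set (B := norm (minus (f x0) x0) / (1 - c)).
  assert (HB : B = c * B + norm (minus (f x0) x0)) by (unfold B; field; lra).
  assert (B0 : 0 <= B) by (apply Rdiv_le_0_compat; [apply norm_nonneg|lra]).
  assert (H1 : forall k, norm (minus (u k) (u 0%nat)) <= B).
  { induction k as [|k IH].
    - rewrite norm_minus_diag; easy.
    - eapply Rle_trans; [apply (norm_chain _ (f (u 0%nat)))|].
      rewrite HB; apply Rplus_le_compat; [|apply Rle_refl].
      eapply Rle_trans; [apply Hf|]; now apply Rmult_le_compat_l. }
  assert (H2 : forall n k, norm (minus (u (n + k)%nat) (u n)) <= c ^ n * B).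
  { induction n as [|n IH]; intros k.
    - rewrite pow_O, Rmult_1_l; apply H1.
    - simpl; eapply Rle_trans; [apply Hf|]; rewrite Rmult_assoc.
      apply Rmult_le_compat_l; [easy|apply IH]. }
  assert (H3 : forall eps, 0 < eps -> exists N, forall n k, (N <= n)%nat ->
     norm (minus (u (n + k)%nat) (u n)) < eps).
  { intros eps He.
    destruct (pow_lt_1_zero c) with (y := eps / (B + 1)) as [N HN].
    - rewrite Rabs_pos_eq; lra.
    - apply Rdiv_lt_0_compat; lra.
    - exists N; intros n k Hn; eapply Rle_lt_trans; [apply H2|].
      specialize (HN n Hn). rewrite Rabs_pos_eq in HN by (apply pow_le; lra).
      apply Rle_lt_trans with (c ^ n * (B + 1)).
      + apply Rmult_le_compat_l; [apply pow_le|]; lra.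
      + apply Rlt_div_r in HN; [|lra]; exact HN. }
  destruct (Hc u) as [l Hl].
  { intros eps He; destruct (H3 eps He) as [N HN]; exists N; intros m n Hm Hn.
    destruct (Nat.le_ge_cases m n) as [h|h].
    - replace n with (m + (n - m))%nat by lia; rewrite norm_minus_sym; auto.
    - replace m with (n + (m - n))%nat by lia; auto. }
  exists l; split.
  - apply closed_approx; [easy|]; intros eps He; destruct (Hl eps He) as [N HN].
    exists (u N); split; [|now apply HN].
    clear -H0 HDf; induction N; simpl; auto.
  - apply norm_minus_eps; intros eps He; destruct (Hl (eps / 2)) as [N HN]; [lra|].
    eapply Rle_trans; [apply (norm_chain _ (u (S N)))|].
    assert (norm (minus (f l) (u (S N))) <= norm (minus (u N) l)).
    { simpl; rewrite norm_minus_sym; eapply Rle_trans; [apply Hf|].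
      rewrite <- (Rmult_1_l (norm (minus _ _))) at 2; fold (u N).
      apply Rmult_le_compat_r; [apply norm_nonneg|lra]. }
    generalize (HN N (Nat.le_refl _)) (HN (S N) (Nat.le_succ_diag_r _)); lra.
Qed.

Lemma closed_true : closed (fun _ : V => True).
Proof. now intros x. Qed.

Lemma linear_of_bound {W : NormedModule R_AbsRing} (f : V -> W) (M : R) :
  (forall x y, f (plus x y) = plus (f x) (f y)) ->
  (forall (k : R) x, f (scal k x) = scal k (f x)) ->
  (forall x, norm (f x) <= M * norm x) -> is_linear f.
Proof.
  intros Hp Hs Hn; split; auto.
  exists (Rmax M 1); split; [apply Rlt_le_trans with 1; [lra|apply Rmax_r]|].
  intros x; eapply Rle_trans; [apply Hn|].
  apply Rmult_le_compat_r; [apply norm_nonneg|apply Rmax_l].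
Qed.

Lemma continuous_norm_iff {U : UniformSpace} (f : U -> V) (x : U) :
  continuous f x <-> forall eps, 0 < eps -> locally x (fun y : U => norm (minus (f y) (f x)) < eps).
Proof.
  split.
  - intros H eps He; apply (H (fun z => norm (minus z (f x)) < eps)), locally_norm_iff; exists eps; auto.
  - intros H P HP; apply locally_norm_iff in HP; destruct HP as (e & He & HP).
    apply (filter_imp (F := locally x)) with (2 := H e He); auto.
Qed.

End Norms.

Arguments seq_complete V : clear implicits.

Lemma continuous_of_lipschitz {V W : NormedModule R_AbsRing} (f : W -> V) (L : R) :
  (forall x y, norm (minus (f x) (f y)) <= L * norm (minus x y)) ->
  forall x, continuous f x.
Proof.
  intros H x; apply continuous_norm_iff; intros eps He; apply locally_norm_iff.
  exists (eps / (Rabs L + 1)); split; [apply Rdiv_lt_0_compat; [easy|generalize (Rabs_pos L); lra]|].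
  intros y Hy; eapply Rle_lt_trans; [apply H|].
  apply Rlt_div_r in Hy; [|generalize (Rabs_pos L); lra].
  eapply Rle_lt_trans; [|apply Hy].
  rewrite Rmult_comm; apply Rmult_le_compat_l; [apply @norm_ge_0|].
  generalize (Rle_abs L); lra.
Qed.

Lemma continuous_R_iff {U : UniformSpace} (f : U -> R) (x : U) :
  continuous f x <-> forall eps, 0 < eps -> locally x (fun y => Rabs (f y - f x) < eps).
Proof. exact (continuous_norm_iff (V := R_NormedModule) f x). Qed.

Lemma Banach_seq_complete (X : Banach) : seq_complete X.
Proof.
  intros u Hu.
  destruct (proj1 (filterlim_locally_cauchy (F := eventually) u)) as [l Hl].
  - intros eps; destruct (Hu eps (cond_pos eps)) as [N HN].
    exists (fun n => (N <= n)%nat); split; [now exists N|].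
    intros m n Hm Hn; apply (norm_compat1 (V := X)); now apply HN.
  - exists l; intros eps He.
    assert (H : locally l (fun y : X => norm (minus y l) < eps)).
    { apply (locally_norm_iff (V := X) l); now exists eps. }
    exact (Hl _ H).
Qed.

Lemma prod_seq_complete (U V : NormedModule R_AbsRing) :
  seq_complete U -> seq_complete V -> seq_complete (prod_NormedModule R_AbsRing U V).
Proof.
  intros HU HV u Hu.
  destruct (HU (fun n => fst (u n))) as [a Ha].
  { intros eps He; destruct (Hu eps He) as [N HN]; exists N; intros m n Hm Hn.
    eapply Rle_lt_trans; [|apply (HN m n Hm Hn)].
    exact (norm_le_prod_norm_1 (minus (u m) (u n))). }
  destruct (HV (fun n => snd (u n))) as [b Hb].
  { intros eps He; destruct (Hu eps He) as [N HN]; exists N; intros m n Hm Hn.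
    eapply Rle_lt_trans; [|apply (HN m n Hm Hn)].
    exact (norm_le_prod_norm_2 (minus (u m) (u n))). }
  exists (a, b); intros eps He.
  destruct (Ha (eps / 2)) as [N1 H1]; [lra|]; destruct (Hb (eps / 2)) as [N2 H2]; [lra|].
  exists (Nat.max N1 N2); intros n Hn.
  eapply Rle_lt_trans; [apply norm_prod|].
  specialize (H1 n ltac:(lia)); specialize (H2 n ltac:(lia)).
  assert (H : Rmax (norm (minus (fst (u n)) a)) (norm (minus (snd (u n)) b)) < eps / 2).
  { apply Rmax_lub_lt; auto. }
  assert (S2 : sqrt 2 < 2).
  { rewrite <- (sqrt_square 2) at 2 by lra; apply sqrt_lt_1; lra. }
  assert (0 <= sqrt 2) by apply sqrt_pos.
  assert (H3 : 0 <= Rmax (norm (minus (fst (u n)) a)) (norm (minus (snd (u n)) b))).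
  { eapply Rle_trans; [|apply Rmax_l]; apply norm_nonneg. }
  assert (E : forall m, 0 <= m -> m < eps / 2 -> sqrt 2 * m < eps) by (intros; nra).
  exact (E _ H3 H).
Qed.

(** * Integrals *)

Lemma Riemann_sum_linear {V W : NormedModule R_AbsRing} (l : V -> W) (f : R -> V) ptd :
  is_linear l -> l (Riemann_sum f ptd) = Riemann_sum (fun t => l (f t)) ptd.
Proof.
  intros Hl; unfold Riemann_sum; destruct ptd as [h t]; simpl.
  generalize (h, zero : R) as p; induction t as [|q t IH]; intros p; simpl.
  - exact (linear_zero l Hl).
  - etransitivity; [exact (linear_plus l Hl _ _)|].
    apply f_equal2; [exact (linear_scal l Hl _ _)|exact (IH q)].
Qed.

Lemma is_RInt_linear {V W : NormedModule R_AbsRing} (l : V -> W) (f : R -> V) a b I :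
  is_linear l -> is_RInt f a b I -> is_RInt (fun t => l (f t)) a b (l I).
Proof.
  intros Hl Hf; unfold is_RInt.
  apply filterlim_ext with (fun ptd => l (scal (sign (b - a)) (Riemann_sum f ptd))).
  - intros ptd; etransitivity; [exact (linear_scal l Hl _ _)|].
    f_equal; now apply Riemann_sum_linear.
  - eapply filterlim_comp; [exact Hf|exact (linear_cont l I Hl)].
Qed.

Lemma Riemann_sum_cone {X : Banach} (K : X -> Prop) (f : R -> X) ptd :
  cone K -> (forall t, K (f t)) -> pointed_subdiv ptd -> K (Riemann_sum f ptd).
Proof.
  intros HK Hf; unfold Riemann_sum, pointed_subdiv, SF_size; destruct ptd as [h t]; simpl.
  intros Hp.
  assert (H : forall h' y', h' = h -> K (seq.foldr plus zero
    (seq.pairmap (fun x y : R * R => scal (fst y - fst x) (f (snd y))) (h', y') t))).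
  2: now apply H.
  revert h Hp; induction t as [|q t IH]; intros h Hp h' y' ->; simpl.
  - apply (cone_zero K HK).
  - apply (cone_plus K HK).
    + apply (cone_scal K HK); [|apply Hf].
      generalize (Hp 0%nat ltac:(simpl; lia)); simpl; unfold Rminus; lra.
    + destruct q as [x y]; apply (IH x); [|easy].
      intros i Hi; exact (Hp (S i) ltac:(simpl; lia)).
Qed.

(** Riemann sums are nonnegative combinations of values in [K], and [K] is closed. *)
Lemma is_RInt_cone {X : Banach} (K : X -> Prop) (f : R -> X) a b I :
  cone K -> a < b -> (forall t, a <= t <= b -> K (f t)) -> is_RInt f a b I -> K I.
Proof.
  intros HK Hab Hf HI.
  (* [Riemann_sum_cone] wants values in [K] at every real, so the integrand is frozen outside
     [[a, b]]. *)
  assert (HI' : is_RInt (fun t => f (Rmax a (Rmin b t))) a b I).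
  { apply is_RInt_ext with f; [|exact HI].
    rewrite Rmin_left, Rmax_right by lra; intros x Hx.
    now rewrite Rmin_right, Rmax_right by (try rewrite Rmin_right; lra). }
  refine (closed_filterlim_loc _ K I HI' _ (cone_closed K HK)).
  exists (mkposreal 1 Rlt_0_1); intros ptd _ [Hp _].
  apply (cone_scal K HK); [rewrite sign_eq_1; lra|].
  refine (Riemann_sum_cone K _ ptd HK _ Hp); intros t; apply Hf.
  unfold Rmax, Rmin; destruct (Rle_dec b t); destruct (Rle_dec a _); lra.
Qed.

(** * Maps of class C1 *)

(** The bound [M] excludes an infinite supremum, which [real] would send to 0. *)
Lemma le_real_Lub_Rbar (E : R -> Prop) (M c : R) :
  (forall x, E x -> x <= M) -> E c -> c <= real (Lub_Rbar E).
Proof.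
  intros HM Hc; destruct (Lub_Rbar_correct E) as [Hub Hl].
  assert (H1 := Hub c Hc).
  assert (H2 : Rbar_le (Lub_Rbar E) M) by (apply Hl; intros x Hx; now apply HM).
  destruct (Lub_Rbar E); simpl in *; easy.
Qed.

Section Linear.
Context {X : Banach}.

Lemma Banach_norm_zero : norm (zero : X) = 0.
Proof. exact (norm_zero (V := X)). Qed.

Lemma lin_plus (A : X -> X) (HA : is_linear A) x y : A (plus x y) = plus (A x) (A y).
Proof. exact (linear_plus A HA x y). Qed.
Lemma lin_scal (A : X -> X) (HA : is_linear A) (k : R) x : A (scal k x) = scal k (A x).
Proof. exact (linear_scal A HA k x). Qed.
Lemma lin_minus (A : X -> X) (HA : is_linear A) x y : A (minus x y) = minus (A x) (A y).
Proof. exact (linear_minus A x y HA). Qed.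
Lemma lin_zero (A : X -> X) (HA : is_linear A) : A zero = zero.
Proof. exact (linear_zero A HA). Qed.

Lemma fun_plus (f : X -> R) (Hf : functional f) x y : f (plus x y) = f x + f y.
Proof. exact (linear_plus f Hf x y). Qed.
Lemma fun_scal (f : X -> R) (Hf : functional f) (k : R) x : f (scal k x) = k * f x.
Proof. exact (linear_scal f Hf k x). Qed.
Lemma fun_minus (f : X -> R) (Hf : functional f) x y : f (minus x y) = f x - f y.
Proof. exact (linear_minus f x y Hf). Qed.
Lemma fun_zero (f : X -> R) (Hf : functional f) : f zero = 0.
Proof. exact (linear_zero f Hf). Qed.
Lemma fun_bound (f : X -> R) (Hf : functional f) :
  exists M, 0 < M /\ forall x, Rabs (f x) <= M * norm x.
Proof. exact (linear_norm f Hf). Qed.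

End Linear.

Lemma opnorm_bound {X : Banach} (A : X -> X) x :
  is_linear A -> norm (A x) <= opnorm A * norm x.
Proof.
  intros HA; destruct (linear_norm A HA) as (M & HM & HAM).
  destruct (Req_dec (norm x) 0) as [H0|H0].
  { generalize (HAM x); rewrite H0; lra. }
  assert (Hx : 0 < norm x) by (generalize (norm_nonneg (V := X) x); lra).
  assert (H : norm (A (scal (/ norm x) x)) <= opnorm A).
  { apply le_real_Lub_Rbar with M.
    - intros c (y & _ & Hy & ->); eapply Rle_trans; [apply HAM|].
      rewrite <- (Rmult_1_r M) at 2; apply Rmult_le_compat_l; lra.
    - exists (scal (/ norm x) x); repeat split; try easy.
      rewrite (norm_scal_eq (V := X)), Rabs_pos_eq, Rinv_l by (try apply Rlt_le, Rinv_0_lt_compat; easy).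
      apply Rle_refl. }
  rewrite (lin_scal A HA (/ norm x) x), (norm_scal_eq (V := X)), Rabs_pos_eq in H
    by (apply Rlt_le, Rinv_0_lt_compat, Hx).
  apply Rmult_le_reg_l with (/ norm x); [now apply Rinv_0_lt_compat|].
  replace (/ norm x * (opnorm A * norm x)) with (opnorm A) by now field.
  exact H.
Qed.

Lemma is_linear_diff_map {X : Banach} (A B : X -> X) :
  is_linear A -> is_linear B -> is_linear (diff_map A B).
Proof.
  intros HA HB; destruct (linear_norm A HA) as (M & HM & HAM).
  destruct (linear_norm B HB) as (N & HN & HBN).
  apply (linear_of_bound (V := X) (W := X)) with (M + N); unfold diff_map.
  - intros x y; rewrite (lin_plus A HA), (lin_plus B HB); vec X.
  - intros k x; rewrite (lin_scal A HA), (lin_scal B HB); vec X.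
  - intros x; eapply Rle_trans; [apply (norm_minus_triangle (V := X))|].
    rewrite Rmult_plus_distr_r; apply Rplus_le_compat; auto.
Qed.

Lemma is_linear_shift {X : Banach} (A : X -> X) k :
  is_linear A -> is_linear (shift A k).
Proof.
  intros HA; destruct (linear_norm A HA) as (M & HM & HAM).
  apply (linear_of_bound (V := X) (W := X)) with (M + Rabs k); unfold shift.
  - intros x y; rewrite (lin_plus A HA); vec X.
  - intros l x; rewrite (lin_scal A HA); vec X.
  - intros x; eapply Rle_trans; [apply (norm_triangle (V := X))|].
    rewrite Rmult_plus_distr_r; apply Rplus_le_compat; auto.
    rewrite (norm_scal_eq (V := X)); apply Rle_refl.
Qed.

Section C1.
Context {X : Banach} (P : X -> X) (DP : X -> X -> X) (HP : is_C1 P DP).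

Lemma C1_linear u : is_linear (DP u).
Proof. apply (proj1 HP u). Qed.

Lemma C1_continuous_dir v u : continuous (fun u => DP u v) u.
Proof.
  apply (continuous_norm_iff (V := X)); intros eps He.
  assert (Hv : 0 < norm v + 1) by (generalize (norm_nonneg (V := X) v); lra).
  refine (filter_imp (F := locally u) _ _ _
    (proj2 HP u (eps / (norm v + 1)) (Rdiv_lt_0_compat _ _ He Hv))).
  intros w Hw.
  eapply Rle_lt_trans; [apply (opnorm_bound (diff_map (DP w) (DP u)) v)|].
  { apply is_linear_diff_map; apply C1_linear. }
  apply Rlt_div_r in Hw; [|easy]; generalize (norm_nonneg (V := X) v); intros.
  destruct (Rle_or_lt 0 (opnorm (diff_map (DP w) (DP u)))); nra.
Qed.

Lemma continuous_segment (u d : X) (s : R) : continuous (fun s : R => plus u (scal s d)) s.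
Proof.
  apply (continuous_of_lipschitz (W := R_NormedModule) (V := X) _ (norm d)); intros x y.
  change (norm (minus (plus u (scal x d)) (plus u (scal y d)) : X) <= norm d * Rabs (x - y)).
  replace (minus (plus u (scal x d)) (plus u (scal y d))) with (scal (x - y) d) by vec X.
  rewrite (norm_scal_eq (V := X)), Rmult_comm; apply Rle_refl.
Qed.

Lemma C1_continuous_segment u d v s : continuous (fun s : R => DP (plus u (scal s d)) v) s.
Proof.
  apply (continuous_comp (fun s : R => plus u (scal s d)) (fun u => DP u v)).
  - apply continuous_segment.
  - apply C1_continuous_dir.
Qed.

(** The fundamental theorem of calculus on a segment. It replaces difference quotients by averages
    of [DP], the operators compared in [chord_monotone]. *)
Lemma C1_mean_value u d :
  is_RInt (fun s => DP (plus u (scal s d)) d) 0 1 (minus (P (plus u d)) (P u)).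
Proof.
  replace (P (plus u d)) with (P (plus u (scal 1 d))) by (do 2 f_equal; vec X).
  replace (P u) with (P (plus u (scal 0 d))) by (f_equal; vec X).
  apply (is_RInt_derive (fun s => P (plus u (scal s d)))).
  - intros s _.
    assert (H : @filterdiff R_AbsRing (AbsRing_NormedModule R_AbsRing) X
      (fun s : R => plus u (scal s d)) (locally s) (fun s : R => scal s d)).
    { split; [exact (is_linear_scal_l (K := R_AbsRing) (V := X) _)|].
      intros x Hx eps; apply filter_forall; intros y.
      apply Rle_trans with (norm (zero : X)).
      { right; apply (f_equal (norm (V := X))); change (minus y x) with (y - x); vec X. }
      rewrite Banach_norm_zero; apply Rmult_le_pos; [apply Rlt_le, cond_pos|apply @norm_ge_0]. }
    assert (H' := filterdiff_comp' _ P s _ _ H (proj1 HP _)).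
    split; [exact (is_linear_scal_l (K := R_AbsRing) (V := X) _)|].
    intros x Hx eps; generalize (proj2 H' x Hx eps); apply filter_imp.
    intros y Hy; rewrite <- (lin_scal _ (C1_linear _)); exact Hy.
  - intros s _; apply C1_continuous_segment.
Qed.

(** Adding the constant [scal k d] to the mean value integrand turns [DP] into [shift (DP _) k],
    whose norm is controlled. *)
Lemma C1_lipschitz k delta :
  (forall u, opnorm (shift (DP u) k) <= delta) -> forall u v,
  norm (minus (shift P k u) (shift P k v)) <= delta * norm (minus u v).
Proof.
  intros H u v; set (d := minus u v).
  assert (E : minus (shift P k u) (shift P k v) =
    plus (minus (P (plus v d)) (P v)) (scal (1 - 0) (scal k d))).
  { unfold shift; replace (plus v d) with u by (unfold d; vec X). unfold d; vec X. }
  rewrite E.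
  assert (HI := is_RInt_plus _ _ 0 1 _ _ (C1_mean_value v d) (is_RInt_const 0 1 (scal k d))).
  assert (Hc := is_RInt_const (V := R_NormedModule) 0 1 (delta * norm d)).
  eapply Rle_trans; [refine (norm_RInt_le _ _ 0 1 _ _ Rle_0_1 _ HI Hc)|].
  2: right; change ((1 - 0) * (delta * norm d) = delta * norm d); ring.
  intros s _; eapply Rle_trans; [apply (opnorm_bound (shift (DP (plus v (scal s d))) k) d)|].
  - apply is_linear_shift, C1_linear.
  - apply Rmult_le_compat_r; [apply (norm_nonneg (V := X))|apply H].
Qed.

End C1.

(** * The spectrum *)

(** The lower bound makes [D] injective, so a right inverse chosen pointwise inherits linearity from
    [D] and is also a left inverse. *)
Lemma is_linear_inverse {V : NormedModule R_AbsRing} (D Q : V -> V) (C : R) :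
  (forall x y, D (plus x y) = plus (D x) (D y)) ->
  (forall (k : R) x, D (scal k x) = scal k (D x)) ->
  (forall x, D (Q x) = x) -> (forall x, norm x <= C * norm (D x)) ->
  is_linear Q /\ forall x, Q (D x) = x.
Proof.
  intros Hp Hs HQ HC.
  assert (inj : forall x y, D x = D y -> x = y).
  { intros x y H; apply norm_minus_0; eapply Rle_trans; [apply HC|].
    replace (minus x y) with (plus x (scal (-1) y)) by vec V.
    rewrite Hp, Hs, H. replace (plus (D y) (scal (-1) (D y))) with (zero : V) by vec V.
    rewrite (norm_zero (V := V)); lra. }
  split.
  - apply linear_of_bound with C.
    + intros x y; apply inj; now rewrite Hp, !HQ.
    + intros k x; apply inj; now rewrite Hs, !HQ.
    + intros x; rewrite <- (HQ x) at 2; apply HC.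
  - intros x; apply inj; now rewrite HQ.
Qed.

Section Complexification.
Context {X : Banach}.

Lemma cplx_eq (p q : cplx X) : fst p = fst q -> snd p = snd q -> p = q.
Proof. destruct p, q; simpl; congruence. Qed.

Lemma norm_cplx_le (p : cplx X) (m : R) : norm (fst p) <= m -> norm (snd p) <= m -> norm p <= 2 * m.
Proof.
  intros H1 H2; destruct p as [a b]; eapply Rle_trans; [apply norm_prod|].
  assert (S2 : sqrt 2 <= 2).
  { rewrite <- (sqrt_square 2) at 2 by lra; apply sqrt_le_1; lra. }
  apply Rmult_le_compat; [apply sqrt_pos| |easy|now apply Rmax_lub].
  eapply Rle_trans; [|apply Rmax_l]; apply (norm_nonneg (V := X)).
Qed.

Definition creal (x : X) : cplx X := (x, zero).

Lemma norm_creal (x : X) : norm (creal x) <= norm x.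
Proof.
  right; change (sqrt (norm x ^ 2 + norm (zero : X) ^ 2) = norm x).
  rewrite Banach_norm_zero; replace (norm x ^ 2 + 0 ^ 2) with ((norm x)²) by (unfold Rsqr; ring).
  apply sqrt_Rsqr, (norm_nonneg (V := X)).
Qed.

Lemma norm_cscal (z : C) (p : cplx X) : norm (cscal z p) <= 4 * Cmod z * norm p.
Proof.
  destruct z as [a b].
  assert (H := Rmax_Cmod (a, b)); simpl in H.
  assert (Ha : Rabs a <= Cmod (a, b)) by (eapply Rle_trans; [apply Rmax_l|apply H]).
  assert (Hb : Rabs b <= Cmod (a, b)) by (eapply Rle_trans; [apply Rmax_r|apply H]).
  assert (H1 := norm_le_prod_norm_1 (U := X) (V := X) p).
  assert (H2 := norm_le_prod_norm_2 (U := X) (V := X) p).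
  assert (N : forall k x, Rabs k <= Cmod (a, b) -> norm (x : X) <= norm p ->
    norm (scal k x) <= Cmod (a, b) * norm p).
  { intros k x Hk Hx; rewrite (norm_scal_eq (V := X)).
    apply Rmult_le_compat; auto; [apply Rabs_pos|apply (norm_nonneg (V := X))]. }
  replace (4 * Cmod (a, b) * norm p) with
    (2 * (Cmod (a, b) * norm p + Cmod (a, b) * norm p)) by ring.
  apply norm_cplx_le; simpl.
  - eapply Rle_trans; [apply (norm_minus_triangle (V := X))|].
    apply Rplus_le_compat; apply N; auto.
  - eapply Rle_trans; [apply (norm_triangle (V := X))|].
    apply Rplus_le_compat; apply N; auto.
Qed.

Ltac cvec := apply cplx_eq; unfold cscal, cext, Cmult, Cplus, Copp, Cminus; cbn; vec X.

Lemma cscal_cscal (z w : C) (p : cplx X) : cscal z (cscal w p) = cscal (Cmult z w) p.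
Proof. cvec. Qed.

Lemma cscal_1 (p : cplx X) : cscal (RtoC 1) p = p.
Proof. cvec. Qed.

Lemma cscal_plus (z : C) (p q : cplx X) : cscal z (plus p q) = plus (cscal z p) (cscal z q).
Proof. cvec. Qed.

Lemma cscal_minus (z : C) (p q : cplx X) : cscal z (minus p q) = minus (cscal z p) (cscal z q).
Proof. cvec. Qed.

Lemma cscal_plus_l (z w : C) (p : cplx X) : cscal (Cplus z w) p = plus (cscal z p) (cscal w p).
Proof. cvec. Qed.

Lemma cscal_scal (z : C) (k : R) (p : cplx X) : cscal z (scal k p) = scal k (cscal z p).
Proof. cvec. Qed.

Context (T : X -> X) (HT : is_linear T).

Lemma cext_plus p q : cext T (plus p q) = plus (cext T p) (cext T q).
Proof. apply cplx_eq; cbn; apply (lin_plus T HT). Qed.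

Lemma cext_minus p q : cext T (minus p q) = minus (cext T p) (cext T q).
Proof. apply cplx_eq; cbn; apply (lin_minus T HT). Qed.

Lemma cext_scal (k : R) p : cext T (scal k p) = scal k (cext T p).
Proof. apply cplx_eq; cbn; apply (lin_scal T HT). Qed.

Lemma cext_cscal z p : cext T (cscal z p) = cscal z (cext T p).
Proof.
  apply cplx_eq; cbn; rewrite ?(lin_plus T HT), ?(lin_minus T HT), !(lin_scal T HT); easy.
Qed.

Lemma norm_cext (M : R) p : (forall x, norm (T x) <= M * norm x) -> 0 <= M ->
  norm (cext T p) <= 2 * (M * norm p).
Proof.
  intros HM HM0; apply norm_cplx_le; simpl.
  - eapply Rle_trans; [apply HM|]; apply Rmult_le_compat_l; [easy|].
    exact (norm_le_prod_norm_1 (U := X) (V := X) p).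
  - eapply Rle_trans; [apply HM|]; apply Rmult_le_compat_l; [easy|].
    exact (norm_le_prod_norm_2 (U := X) (V := X) p).
Qed.

(** This makes the supremum in [spectral_radius] finite. For large [z] the equation [(z - T) q = p]
    is solved as the fixed point equation [q = z^-1 (p + T q)]. *)
Lemma spectrum_bounded : exists B, forall z, spectrum T z -> Cmod z <= B.
Proof.
  destruct (linear_norm T HT) as (M & HM & HTM).
  (* [cscal] costs a factor 4 and [cext T] a factor [2 * M], so the contraction constant
     [8 * M / Cmod z] is at most 1/2. *)
  exists (16 * M); intros z Hz; apply Rnot_lt_le; intros Hlt; apply Hz; clear Hz.
  assert (Hz0 : z <> RtoC 0) by (intros ->; rewrite Cmod_0 in Hlt; lra).
  assert (Hz : 0 < Cmod z) by lra.
  set (D := fun q : cplx X => minus (cscal z q) (cext T q)).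
  assert (B1 : forall w q, norm (cscal (Cinv z) (plus w (cext T q)) : cplx X)
            <= 4 / Cmod z * norm w + / 2 * norm q).
  { intros w q; eapply Rle_trans; [apply norm_cscal|]; rewrite Cmod_inv by easy.
    assert (H1 := norm_triangle (V := cplx X) w (cext T q)).
    assert (H2 := norm_cext M q HTM (Rlt_le _ _ HM)).
    assert (H3 : 0 < / Cmod z) by now apply Rinv_0_lt_compat.
    assert (H4 : / Cmod z * (16 * M) <= 1).
    { apply Rmult_le_reg_l with (Cmod z); [easy|].
      rewrite <- Rmult_assoc, Rinv_r, Rmult_1_l by lra; lra. }
    assert (H5 := norm_nonneg (V := cplx X) q).
    apply Rle_trans with (4 * / Cmod z * (norm w + 2 * (M * norm q))).
    - apply Rmult_le_compat_l; lra.
    - unfold Rdiv; nra. }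
  assert (EQ : forall p q, cscal (Cinv z) (plus p (cext T q)) = q <-> D q = p).
  { intros p q; unfold D; split.
    - intros H; rewrite <- H at 1; rewrite cscal_cscal, Cinv_r, cscal_1 by easy.
      vec (cplx X).
    - intros <-; transitivity (cscal (Cinv z) (cscal z q)); [f_equal; vec (cplx X)|].
      now rewrite cscal_cscal, Cinv_l, cscal_1. }
  assert (Hex : forall p, exists q, D q = p).
  { intros p.
    destruct (contraction_fixed_point (V := cplx X)
      (prod_seq_complete X X (Banach_seq_complete X) (Banach_seq_complete X))
      (fun q => cscal (Cinv z) (plus p (cext T q))) (/ 2) (fun _ => True) zero) as (q & _ & Hq).
    - lra.
    - intros a b; rewrite <- cscal_minus.
      replace (minus (plus p (cext T a)) (plus p (cext T b)))
        with (plus zero (cext T (minus a b))).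
      + eapply Rle_trans; [apply B1|]. rewrite (norm_zero (V := cplx X)); lra.
      + rewrite cext_minus; vec (cplx X).
    - apply closed_true.
    - easy.
    - easy.
    - exists q; now apply EQ. }
  destruct (choice (fun p q => D q = p) Hex) as [Q HQ].
  assert (HQ2 := is_linear_inverse (V := cplx X) D Q (8 / Cmod z)).
  destruct HQ2 as [H1 H2]; try easy.
  - intros a b; unfold D; rewrite cscal_plus, cext_plus; vec (cplx X).
  - intros k a; unfold D; rewrite cscal_scal, cext_scal; vec (cplx X).
  - intros q; assert (Hq := proj2 (EQ (D q) q) eq_refl).
    assert (H := B1 (D q) q); rewrite Hq in H; unfold Rdiv in *; lra.
  - now exists Q.
Qed.

Lemma spectrum_le_radius z : spectrum T z -> Cmod z <= spectral_radius T.
Proof.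
  intros Hz; destruct spectrum_bounded as [B HB].
  apply le_real_Lub_Rbar with B; [intros m (w & Hw & ->); auto|now exists z].
Qed.

(** For real [l] the operator [l - T] acts separately on real and imaginary parts, so the real part
    of the complex resolvent, taken on real vectors, inverts it. *)
Lemma real_resolvent (l : R) : ~ spectrum T (RtoC l) ->
  exists Q : X -> X, is_linear Q /\
    (forall x, minus (scal l (Q x)) (T (Q x)) = x) /\
    (forall x, Q (minus (scal l x) (T x)) = x).
Proof.
  intros H; apply NNPP in H; destruct H as (Q & HQ & H1 & H2).
  destruct (linear_norm Q HQ) as (M & HM & HQM).
  assert (E : forall x : cplx X, fst (cscal (RtoC l) x) = scal l (fst x)).
  { intros x; cbn; vec X. }
  assert (D0 : forall x, minus (scal l (fst (Q (x, zero)))) (T (fst (Q (x, zero)))) = x).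
  { intros x; rewrite <- E; exact (f_equal fst (H1 (x, zero))). }
  assert (D1 : forall x, fst (Q (minus (scal l x) (T x), zero)) = x).
  { intros x; transitivity (fst (Q (minus (cscal (RtoC l) (x, zero)) (cext T (x, zero))))).
    - do 2 f_equal; apply cplx_eq.
      + cbn; vec X.
      + change (zero = minus (plus (scal l (zero : X)) (scal 0 x)) (T zero)).
        rewrite (lin_zero T HT); vec X.
    - exact (f_equal fst (H2 (x, zero))). }
  exists (fun x => fst (Q (x, zero))); split; [|easy].
  apply (linear_of_bound (V := X) (W := X)) with M.
  - intros x y; etransitivity; [|exact (f_equal fst (linear_plus Q HQ (x, zero) (y, zero)))].
    do 2 f_equal; apply cplx_eq; cbn; vec X.
  - intros k x; etransitivity; [|exact (f_equal fst (linear_scal Q HQ k (x, zero)))].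
    do 2 f_equal; apply cplx_eq; cbn; vec X.
  - intros x; eapply Rle_trans; [apply (norm_le_prod_norm_1 (U := X) (V := X))|].
    eapply Rle_trans; [apply HQM|]; apply Rmult_le_compat_l; [lra|].
    apply norm_creal.
Qed.

End Complexification.

(** * Contour integrals of the resolvent *)

Section Contour.
Context {X : Banach} (T : X -> X) (HT : is_linear T).

Lemma resolvent_comm z Q p : is_resolvent T z Q -> Q (cext T p) = cext T (Q p).
Proof.
  intros (_ & H1 & H2).
  transitivity (Q (minus (cscal z (cext T (Q p))) (cext T (cext T (Q p))))).
  - rewrite <- (H1 p) at 1; f_equal.
    rewrite (cext_minus T HT); f_equal; apply (cext_cscal T HT).
  - apply H2.
Qed.

(** The resolvent identity [Q' - Q = (w - z) Q Q']. The smallness condition makes the right side at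
    most half of [norm (Q' p)], whence the factor 2. *)
Lemma resolvent_near z w Q Q' M p :
  is_resolvent T w Q -> is_resolvent T z Q' -> 0 < M -> (forall q, norm (Q q) <= M * norm q) ->
  8 * M * Cmod (Cminus w z) <= 1 ->
  norm (Q' p) <= 2 * M * norm p /\
  norm (minus (Q' p) (Q p)) <= 8 * M * M * norm p * Cmod (Cminus w z).
Proof.
  intros (HQ & _ & Q2) (_ & Q1' & _) HM0 HM Hwz.
  assert (E : minus (Q' p) (Q p) = Q (cscal (Cminus w z) (Q' p))).
  { transitivity (minus (Q (minus (cscal w (Q' p)) (cext T (Q' p)))) (Q p)); [now rewrite Q2|].
    etransitivity; [symmetry; exact (linear_minus Q _ _ HQ)|]; f_equal.
    rewrite <- (Q1' p) at 3; unfold Cminus.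
    rewrite cscal_plus_l.
    assert (Eo : cscal (Copp z) (Q' p) = opp (cscal z (Q' p))) by (apply cplx_eq; cbn; vec X).
    rewrite Eo; vec (cplx X). }
  assert (B : norm (minus (Q' p) (Q p)) <= M * (4 * Cmod (Cminus w z) * norm (Q' p))).
  { rewrite E; eapply Rle_trans; [apply HM|]; apply Rmult_le_compat_l; [lra|apply norm_cscal]. }
  assert (N0 := norm_nonneg (V := cplx X) (Q' p)).
  assert (C0 := Cmod_ge_0 (Cminus w z)).
  assert (B2 : norm (Q' p) <= 2 * M * norm p).
  { assert (H : norm (Q' p) <= norm (minus (Q' p) (Q p)) + norm (Q p)).
    { eapply Rle_trans; [|apply (norm_triangle (V := cplx X))].
      right; apply (f_equal (norm (V := cplx X))); vec (cplx X). }
    generalize (HM p); nra. }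
  split; [easy|]; eapply Rle_trans; [apply B|].
  apply Rle_trans with (M * (4 * Cmod (Cminus w z) * (2 * M * norm p))); [|right; ring].
  apply Rmult_le_compat_l; [lra|]; apply Rmult_le_compat_l; [|easy]; lra.
Qed.

Context (r rho : R) (Res : C -> cplx X -> cplx X) (Hrho : 0 < rho)
  (HRes : forall z, Cmod (Cminus z (RtoC r)) = rho -> is_resolvent T z (Res z)).

Let Rt (t : R) := Res (circle (RtoC r) rho t).

Lemma circle_eq t : circle (RtoC r) rho t = (r + rho * cos t, rho * sin t).
Proof. unfold circle, Cplus, Cmult; simpl; f_equal; ring. Qed.

Lemma Rt_resolvent t : is_resolvent T (circle (RtoC r) rho t) (Rt t).
Proof.
  apply HRes; rewrite circle_eq; unfold Cmod, Cminus, Cplus, Copp; simpl.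
  replace (_ + _) with (Rsqr rho); [apply sqrt_Rsqr; lra|].
  generalize (sin2_cos2 t); unfold Rsqr; intros H.
  transitivity (rho * rho * (sin t * sin t + cos t * cos t)); [rewrite H|]; ring.
Qed.

Lemma continuous_circle t eps : 0 < eps ->
  locally t (fun s => Cmod (Cminus (circle (RtoC r) rho t) (circle (RtoC r) rho s)) < eps).
Proof.
  intros He.
  assert (He' : 0 < eps / (4 * rho)) by (apply Rdiv_lt_0_compat; lra).
  assert (H1 := proj1 (continuous_R_iff cos t) (continuous_cos t) _ He').
  assert (H2 := proj1 (continuous_R_iff sin t) (continuous_sin t) _ He').
  generalize (filter_and (F := locally t) _ _ H1 H2); apply filter_imp; intros s [A B].
  rewrite !circle_eq; unfold Cminus, Cplus, Copp; simpl.
  eapply Rle_lt_trans; [apply Cmod_2Rmax|]; simpl.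
  assert (S2 : sqrt 2 <= 2).
  { rewrite <- (sqrt_square 2) at 2 by lra; apply sqrt_le_1; lra. }
  assert (Z : forall u v, Rabs (v - u) < eps / (4 * rho) ->
    Rabs (rho * u - rho * v) <= eps / 4).
  { intros u v H; replace (rho * u - rho * v) with (rho * (u - v)) by ring.
    rewrite Rabs_mult, (Rabs_pos_eq rho), Rabs_minus_sym by lra.
    replace (eps / 4) with (rho * (eps / (4 * rho))) by (field; lra).
    apply Rmult_le_compat_l; lra. }
  apply Rle_lt_trans with (2 * (eps / 4)); [|lra].
  apply Rmult_le_compat; [apply sqrt_pos| |easy|].
  - eapply Rle_trans; [apply Rabs_pos|apply Rmax_l].
  - apply Rmax_lub.
    + replace (r + rho * cos t + - (r + rho * cos s)) with (rho * cos t - rho * cos s) by ring.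
      now apply Z.
    + replace (rho * sin t + - (rho * sin s)) with (rho * sin t - rho * sin s) by ring.
      now apply Z.
Qed.

Lemma Rt_near t : exists M, 0 < M /\ forall eta, 0 < eta -> locally t (fun s => forall p,
  norm (Rt s p) <= M * norm p /\ norm (minus (Rt s p) (Rt t p)) <= eta * norm p).
Proof.
  destruct (linear_norm (Rt t)) as (M & HM & HB); [apply Rt_resolvent|].
  exists (2 * M); split; [lra|]; intros eta Heta.
  assert (He1 : 0 < / (8 * M)) by (apply Rinv_0_lt_compat; lra).
  assert (He2 : 0 < eta / (8 * M * M)) by (apply Rdiv_lt_0_compat; [|apply Rmult_lt_0_compat]; lra).
  generalize (filter_and (F := locally t) _ _ (continuous_circle t _ He1) (continuous_circle t _ He2)).
  apply filter_imp; intros s [A B] p.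
  destruct (resolvent_near (circle (RtoC r) rho s) (circle (RtoC r) rho t) (Rt t) (Rt s) M p)
    as [H1 H2]; auto using Rt_resolvent.
  - apply Rlt_le in A; apply (Rmult_le_compat_l (8 * M)) in A; [|lra].
    rewrite Rinv_r in A by lra; lra.
  - split; [easy|]; eapply Rle_trans; [apply H2|].
    apply Rlt_le in B; apply (Rmult_le_compat_l (8 * M * M)) in B; [|nra].
    replace (8 * M * M * (eta / (8 * M * M))) with eta in B by (field; lra).
    assert (N0 := norm_nonneg (V := cplx X) p); nra.
Qed.

Lemma Rt_continuous p t : continuous (fun s => Rt s p) t.
Proof.
  apply (continuous_norm_iff (V := cplx X)); intros eps He.
  destruct (Rt_near t) as (M & _ & H).
  assert (N0 : 0 < norm p + 1) by (apply Rle_lt_0_plus_1, (norm_nonneg (V := cplx X))).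
  generalize (H (eps / (norm p + 1)) (Rdiv_lt_0_compat _ _ He N0)); apply filter_imp.
  intros s Hs; destruct (Hs p) as [_ Hp]; eapply Rle_lt_trans; [apply Hp|].
  apply Rlt_le_trans with (eps / (norm p + 1) * (norm p + 1)); [|right; field; lra].
  apply Rmult_lt_compat_l; [apply Rdiv_lt_0_compat|]; lra.
Qed.

(** Compactness of the interval. Each [t] receives one number [d] that is a radius and whose inverse
    bounds the resolvents within that radius; a uniform lower bound for the radii is then a uniform
    bound for the norms. *)
Lemma Rt_bounded : exists M, 0 < M /\ forall t p, 0 <= t <= 2 * PI -> norm (Rt t p) <= M * norm p.
Proof.
  assert (H : forall t, exists d : posreal, forall s, Rabs (s - t) < d ->
    forall p, norm (Rt s p) <= / d * norm p).
  { intros t; destruct (Rt_near t) as (M & HM & HN).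
    destruct (HN 1 Rlt_0_1) as [e He].
    assert (Hd : 0 < Rmin e (/ M)).
    { apply Rmin_pos; [apply cond_pos|now apply Rinv_0_lt_compat]. }
    exists (mkposreal _ Hd); simpl; intros s Hs p.
    eapply Rle_trans; [apply (He s)|].
    - apply Rlt_le_trans with (1 := Hs), Rmin_l.
    - apply Rmult_le_compat_r; [apply (norm_nonneg (V := cplx X))|].
      rewrite <- (Rinv_inv M) at 1; apply Rinv_le_contravar; [easy|apply Rmin_r]. }
  destruct (choice _ H) as [delta Hdelta].
  destruct (compactness_value_1d 0 (2 * PI) delta) as [d Hd].
  exists (/ d); split; [apply Rinv_0_lt_compat, cond_pos|].
  intros t p Ht; specialize (Hd t Ht); apply NNPP in Hd; destruct Hd as (s & _ & Hs & Hds).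
  eapply Rle_trans; [apply (Hdelta s t Hs)|].
  apply Rmult_le_compat_r; [apply (norm_nonneg (V := cplx X))|].
  apply Rinv_le_contravar; [apply cond_pos|easy].
Qed.

Lemma contour_weight t :
  Cmult (Cinv (Cmult (RtoC (2 * PI)) Ci)) (circle_deriv rho t) =
  (rho / (2 * PI) * cos t, rho / (2 * PI) * sin t).
Proof.
  generalize PI_RGT_0; intros Hpi; unfold circle_deriv.
  apply injective_projections; simpl; field; lra.
Qed.

Context (E : cplx X -> cplx X) (HE : forall p, is_RInt (fun t =>
  cscal (Cmult (Cinv (Cmult (RtoC (2 * PI)) Ci)) (circle_deriv rho t)) (Rt t p)) 0 (2 * PI) (E p)).

(* [(z - r)^-1 dz] is [i dt] on the circle, so [G] is the contour integral of
   [(z - T)^-1 / (z - r)]; multiplying by [T - r = (z - r) - (z - T)] leaves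
   the spectral projection minus the identity. *)
Lemma contour_inverse : exists G : X -> X, is_linear G /\ forall x,
  shift T (- r) (G x) = minus (fst (E (creal x))) x /\
  G (shift T (- r) x) = minus (fst (E (creal x))) x.
Proof.
  assert (Hpi := PI_RGT_0).
  set (g := fun x t => scal (/ (2 * PI)) (fst (Rt t (creal x)) : X)).
  assert (Hex : forall x, exists y, is_RInt (g x) 0 (2 * PI) y).
  { intros x; apply (ex_RInt_continuous (V := X)); intros t _.
    apply (continuous_comp (fun t => Rt t (creal x)) (fun p : cplx X => scal (/ (2 * PI)) (fst p))).
    - apply Rt_continuous.
    - apply (linear_cont (fun p : cplx X => scal (/ (2 * PI)) (fst p))).
      apply (is_linear_comp (fun p : cplx X => fst p) (fun x : X => scal (/ (2 * PI)) x)).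
      + apply is_linear_fst.
      + exact (is_linear_scal_r (K := R_AbsRing) (V := X) (/ (2 * PI)) Rmult_comm). }
  destruct (choice _ Hex) as [G HG].
  assert (uniq : forall (f : R -> X) a b, is_RInt f 0 (2 * PI) a -> is_RInt f 0 (2 * PI) b -> a = b).
  { intros f a b Ha Hb; now rewrite <- (is_RInt_unique f _ _ a Ha), (is_RInt_unique f _ _ b Hb). }
  assert (HR : forall t, is_linear (Rt t)) by (intros t; apply Rt_resolvent).
  assert (HS : is_linear (shift T (- r))) by now apply is_linear_shift.
  assert (comm : forall t x, g (shift T (- r) x) t = shift T (- r) (g x t)).
  { intros t x; unfold g, shift; rewrite (lin_scal T HT).
    transitivity (scal (/ (2 * PI)) (fst (plus (Rt t (cext T (creal x)))
      (scal (- r) (Rt t (creal x))) : cplx X) : X)).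
    - f_equal; rewrite <- (linear_scal (Rt t) (HR t)), <- (linear_plus (Rt t) (HR t)).
      do 2 f_equal; apply cplx_eq; [cbn; vec X|].
      change (zero = plus (T zero) (scal (- r) (zero : X))); rewrite (lin_zero T HT); vec X.
    - rewrite (resolvent_comm _ _ _ (Rt_resolvent t)).
      generalize (Rt t (creal x)); intros q; cbn; vec X. }
  assert (GT : forall x, shift T (- r) (G x) = minus (fst (E (creal x))) x).
  { intros x; apply uniq with (fun t => shift T (- r) (g x t)).
    - apply (is_RInt_linear (V := X) (W := X)); auto.
    - assert (H1 := is_RInt_fct_extend_fst (U := X) (V := X) _ _ _ _ (HE (creal x))).
      assert (H2 := is_RInt_const (V := X) 0 (2 * PI) (scal (/ (2 * PI)) x)).
      assert (H3 := is_RInt_minus _ _ _ _ _ _ H1 H2).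
      replace (minus (fst (E (creal x))) x) with
        (minus (fst (E (creal x))) (scal (2 * PI - 0) (scal (/ (2 * PI)) x)))
        by (vec_eq X; field; lra).
      revert H3; apply is_RInt_ext; intros t _; rewrite contour_weight.
      assert (H := proj1 (proj2 (Rt_resolvent t)) (creal x)); rewrite circle_eq in H.
      apply (f_equal fst) in H; unfold g, shift; rewrite (lin_scal T HT).
      destruct (Rt t (creal x)) as [a b]; cbn in H |- *.
      replace (T a) with (minus (minus (scal (r + rho * cos t) a) (scal (rho * sin t) b)) x).
      + vec_eq X; field; lra.
      + rewrite <- H at 1; vec X. }
  exists G; split.
  - destruct Rt_bounded as (M & HM & HB).
    apply (linear_of_bound (V := X) (W := X)) with M.
    + intros x y; apply uniq with (g (plus x y)); [apply HG|].
      eapply is_RInt_ext; [|exact (is_RInt_plus _ _ _ _ _ _ (HG x) (HG y))].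
      intros t _; unfold g; cbn beta.
      transitivity (scal (/ (2 * PI)) (fst (Rt t (plus (creal x) (creal y))) : X)).
      * rewrite (linear_plus (Rt t) (HR t)); cbn; vec X.
      * do 3 f_equal; apply cplx_eq; cbn; vec X.
    + intros k x; apply uniq with (g (scal k x)); [apply HG|].
      eapply is_RInt_ext; [|exact (is_RInt_scal _ _ _ k _ (HG x))].
      intros t _; unfold g; cbn beta.
      transitivity (scal (/ (2 * PI)) (fst (Rt t (scal k (creal x))) : X)).
      * rewrite (linear_scal (Rt t) (HR t)); cbn; vec X.
      * do 3 f_equal; apply cplx_eq; cbn; vec X.
    + intros x.
      assert (Hc := is_RInt_const (V := R_NormedModule) 0 (2 * PI) (/ (2 * PI) * (M * norm x))).
      eapply Rle_trans; [refine (norm_RInt_le _ _ _ _ _ _ _ _ (HG x) Hc); [lra|]|].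
      * intros t Ht; unfold g; rewrite (norm_scal_eq (V := X)).
        rewrite Rabs_pos_eq by (apply Rlt_le, Rinv_0_lt_compat; lra).
        apply Rmult_le_compat_l; [apply Rlt_le, Rinv_0_lt_compat; lra|].
        eapply Rle_trans; [apply (norm_le_prod_norm_1 (U := X) (V := X))|].
        eapply Rle_trans; [apply HB, Ht|]; apply Rmult_le_compat_l; [lra|].
        apply norm_creal.
      * right; change ((2 * PI - 0) * (/ (2 * PI) * (M * norm x)) = M * norm x); field; lra.
  - intros x; split; [apply GT|]; rewrite <- GT.
    apply uniq with (g (shift T (- r) x)); [apply HG|].
    eapply is_RInt_ext; [|exact (is_RInt_linear (V := X) (W := X) _ _ _ _ _ HS (HG x))].
    intros t _; symmetry; apply comm.
Qed.

(** On an eigenvector the resolvent is multiplication by [(z - r)^-1], which cancels the weight and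
    leaves the constant integrand [a / (2 * PI)]. *)
Lemma contour_eigen a : T a = scal r a -> E (creal a) = (creal a).
Proof.
  intros Ha; assert (Hpi := PI_RGT_0).
  assert (K : forall t, cscal (Cmult (Cinv (Cmult (RtoC (2 * PI)) Ci)) (circle_deriv rho t))
    (Rt t (creal a)) = (scal (/ (2 * PI)) a, zero)).
  { intros t; rewrite contour_weight.
    assert (S := sin2_cos2 t); unfold Rsqr in S.
    assert (Sq : cos t * cos t = 1 - sin t * sin t) by lra.
    assert (E1 : Rt t (creal a) = cscal (/ rho * cos t, - (/ rho * sin t)) (creal a)).
    { rewrite <- (proj2 (proj2 (Rt_resolvent t)) (cscal (/ rho * cos t, - (/ rho * sin t)) (creal a))).
      f_equal; rewrite circle_eq, (cext_cscal T HT).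
      replace (cext T (creal a)) with (scal r (creal a)).
      - apply cplx_eq; cbn; vec_eq X.
        + transitivity (cos t * cos t + sin t * sin t); [rewrite Sq; ring|field; lra].
        + field; lra.
      - apply cplx_eq; [symmetry; exact Ha|].
        change (scal r (zero : X) = T zero); rewrite (lin_zero T HT); vec X. }
    rewrite E1, cscal_cscal; apply cplx_eq; cbn; vec_eq X.
    - transitivity (/ (2 * PI) * (cos t * cos t + sin t * sin t)); [field; lra|rewrite Sq; ring].
    - field; lra. }
  assert (H1 := HE (creal a)).
  apply cplx_eq.
  - apply is_RInt_fct_extend_fst, is_RInt_unique in H1; rewrite <- H1.
    etransitivity; [apply RInt_ext; intros t _; rewrite K; reflexivity|].
    rewrite (is_RInt_unique _ _ _ _ (is_RInt_const (V := X) _ _ _)); simpl.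
    vec_eq X; field; lra.
  - apply is_RInt_fct_extend_snd, is_RInt_unique in H1; rewrite <- H1.
    etransitivity; [apply RInt_ext; intros t _; rewrite K; reflexivity|].
    rewrite (is_RInt_unique _ _ _ _ (is_RInt_const (V := X) _ _ _)); simpl.
    vec X.
Qed.

End Contour.

Lemma scal_inj {X : Banach} (a : X) (k l : R) : a <> zero -> scal k a = scal l a -> k = l.
Proof.
  intros Ha H; destruct (Req_dec k l) as [|Hkl]; [easy|exfalso; apply Ha].
  replace a with (scal (/ (k - l)) (minus (scal k a) (scal l a))) by (vec_eq X; field; lra).
  rewrite H; vec X.
Qed.

Lemma elementary_splitting {X : Banach} (T : X -> X) (r : R) :
  is_linear T -> elementary_eigenvalue T (RtoC r) ->
  exists (a : X) (f : X -> R) (G : X -> X),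
    a <> zero /\ T a = scal r a /\ functional f /\ f a = 1 /\ is_linear G /\
    (forall x, f (shift T (- r) x) = 0) /\
    (forall x, shift T (- r) (G x) = minus x (scal (f x) a)) /\
    (forall x, G (shift T (- r) x) = minus x (scal (f x) a)).
Proof.
  intros HT (_ & E & v & HE & (Hv & HTv) & Hran).
  destruct HE as (rho & Res & Hrho & _ & HRes & HI).
  destruct (contour_inverse T HT r rho Res Hrho HRes E HI) as (G & HG & HGE).
  assert (HEa := contour_eigen T HT r rho Res Hrho HRes E HI).
  assert (Tv : T (fst v) = scal r (fst v) /\ T (snd v) = scal r (snd v)).
  { split.
    - transitivity (fst (cscal (RtoC r) v)); [exact (f_equal fst HTv)|cbn; vec X].
    - transitivity (snd (cscal (RtoC r) v)); [exact (f_equal snd HTv)|cbn; vec X]. }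
  (* [v] is a complex vector; since [r] is real, its real and imaginary parts both satisfy the
     eigenvalue equation, and one of them is nonzero. *)
  assert (Ha : exists a, a <> zero /\ T a = scal r a).
  { destruct (classic (fst v = zero)) as [H1|H1]; [|exists (fst v); tauto].
    exists (snd v); split; [|tauto].
    intros H2; apply Hv, cplx_eq; assumption. }
  destruct Ha as (a & Ha0 & Ha).
  (* Rank one descends to the reals: [b] is a complex multiple of [a], and comparing real parts
     leaves the real part of the factor. *)
  assert (dim1 : forall b, T b = scal r b -> exists k, b = scal k a).
  { intros b Hb.
    destruct (proj1 (Hran (creal a)) (ex_intro _ _ (eq_sym (HEa a Ha)))) as [c Hc].
    destruct (proj1 (Hran (creal b)) (ex_intro _ _ (eq_sym (HEa b Hb)))) as [d Hd].
    assert (Hc0 : c <> RtoC 0).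
    { intros ->; apply Ha0; change (fst (creal a) = zero); rewrite Hc; cbn; vec X. }
    exists (fst (Cmult d (Cinv c))).
    transitivity (fst (cscal (Cmult d (Cinv c)) (creal a))); [|cbn; vec X].
    rewrite Hc, cscal_cscal, <- Cmult_assoc, Cinv_l, Cmult_1_r by easy.
    now rewrite <- Hd. }
  assert (HEr : forall x, T (fst (E (creal x))) = scal r (fst (E (creal x)))).
  { intros x; destruct (proj1 (Hran (E (creal x))) (ex_intro _ _ eq_refl)) as [c ->].
    destruct c as [c1 c2], Tv as [T1 T2]; change (T (minus (scal c1 (fst v)) (scal c2 (snd v)))
      = scal r (minus (scal c1 (fst v)) (scal c2 (snd v)))).
    rewrite (lin_minus T HT), !(lin_scal T HT), T1, T2; vec X. }
  destruct (choice (fun x k => fst (E (creal x)) = scal k a)) as [f Hf].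
  { intros x; apply dim1, HEr. }
  (* [f] was chosen pointwise; linearity and boundedness are read off this formula, because
     [k |-> scal k a] is injective. *)
  assert (HfG : forall x, scal (f x) a = plus x (shift T (- r) (G x))).
  { intros x; rewrite <- Hf, (proj1 (HGE x)); vec X. }
  assert (HS : is_linear (shift T (- r))) by now apply is_linear_shift.
  assert (Hinj := scal_inj a).
  assert (Na : 0 < norm a).
  { destruct (norm_nonneg (V := X) a) as [|H]; [easy|].
    exfalso; apply Ha0, (norm_eq_zero (V := X)); easy. }
  (* The contour integral gives [(T - r) G = E - 1], hence the change of sign. *)
  exists a, f, (fun x => opp (G x)); repeat split; auto.
  - intros x y; change (f (plus x y) = f x + f y); apply Hinj; [easy|].
    rewrite HfG, (lin_plus G HG), (lin_plus _ HS).
    transitivity (plus (scal (f x) a) (scal (f y) a)); [rewrite !HfG|]; vec X.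
  - intros k x; change (f (scal k x) = k * f x); apply Hinj; [easy|].
    rewrite HfG, (lin_scal G HG), (lin_scal _ HS).
    transitivity (scal k (scal (f x) a)); [rewrite !HfG|]; vec X.
  - destruct (linear_norm _ HS) as (M & HM & HMb); destruct (linear_norm _ HG) as (N & HN & HNb).
    exists ((1 + M * N) / norm a); split; [apply Rdiv_lt_0_compat; nra|].
    intros x; change (Rabs (f x) <= (1 + M * N) / norm a * norm x).
    apply Rmult_le_reg_r with (norm a); [easy|].
    rewrite <- (norm_scal_eq (V := X)), HfG.
    eapply Rle_trans; [apply (norm_triangle (V := X))|].
    replace ((1 + M * N) / norm a * norm x * norm a) with (norm x + M * (N * norm x))
      by (field; lra).
    apply Rplus_le_compat_l; eapply Rle_trans; [apply HMb|].
    apply Rmult_le_compat_l; [lra|apply HNb].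
  - apply Hinj; [easy|]; rewrite <- Hf, (HEa a Ha); cbn; vec X.
  - intros x y; rewrite (lin_plus G HG); vec X.
  - intros k x; rewrite (lin_scal G HG); vec X.
  - destruct (linear_norm _ HG) as (N & HN & HNb); exists N; split; [easy|].
    intros x; rewrite (norm_opp (V := X)); apply HNb.
  (* [G] commutes with [T - r], so [f ((T - r) x) a] equals [(T - r) (f x a)], and [a] is an
     eigenvector. *)
  - intros x; apply Hinj; [easy|]; rewrite HfG, (proj2 (HGE x)), <- (proj1 (HGE x)).
    transitivity (shift T (- r) (plus x (shift T (- r) (G x)))).
    + rewrite !(lin_plus _ HS); f_equal; f_equal; symmetry; rewrite (proj1 (HGE x)); easy.
    + rewrite <- HfG; unfold shift; rewrite (lin_scal T HT), Ha; vec X.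
  - intros x; transitivity (opp (shift T (- r) (G x))).
    + replace (opp (G x)) with (scal (-1) (G x)) by vec X; rewrite (lin_scal _ HS); vec X.
    + rewrite (proj1 (HGE x)), Hf; vec X.
  - intros x; rewrite (proj2 (HGE x)), Hf; vec X.
Qed.

(** * Cones and the principal eigenvector *)

Section Cone.
Context {X : Banach} (K : X -> Prop) (HK : cone K).

Lemma interior_iff x :
  interior K x <-> exists eps, 0 < eps /\ forall y : X, norm (minus y x) < eps -> K y.
Proof. exact (locally_norm_iff (V := X) x K). Qed.

Lemma interior_in x : interior K x -> K x.
Proof.
  intros H; apply interior_iff in H; destruct H as (e & He & H); apply H.
  rewrite (norm_minus_diag (V := X)); lra.
Qed.

Lemma interior_plus x y : interior K x -> K y -> interior K (plus x y).
Proof.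
  intros H Hy; apply interior_iff in H; destruct H as (e & He & H); apply interior_iff.
  exists e; split; [easy|]; intros z Hz.
  replace z with (plus (minus z y) y) by vec X; apply (cone_plus K HK); [|easy].
  apply H; norm_as X (minus z (plus x y)); easy.
Qed.

Lemma interior_scal k x : 0 < k -> interior K x -> interior K (scal k x).
Proof.
  intros Hk H; apply interior_iff in H; destruct H as (e & He & H); apply interior_iff.
  exists (k * e); split; [now apply Rmult_lt_0_compat|]; intros z Hz.
  replace z with (scal k (scal (/ k) z)) by (vec_eq X; field; lra).
  apply (cone_scal K HK); [lra|]; apply H.
  norm_as X (scal (/ k) (minus z (scal k x))).
  rewrite (norm_scal_eq (V := X)), Rabs_pos_eq by (apply Rlt_le, Rinv_0_lt_compat, Hk).
  apply Rmult_lt_reg_l with k; [easy|]; rewrite <- Rmult_assoc, Rinv_r by lra; lra.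
Qed.

Lemma interior_minus_small x y : interior K x -> exists eps, 0 < eps /\ K (minus x (scal eps y)).
Proof.
  intros H; apply interior_iff in H; destruct H as (e & He & H).
  assert (N := norm_nonneg (V := X) y).
  exists (e / 2 / (norm y + 1)); assert (0 < e / 2 / (norm y + 1)).
  { repeat apply Rdiv_lt_0_compat; lra. }
  split; [easy|]; apply H.
  norm_as X (scal (- (e / 2 / (norm y + 1))) y).
  rewrite (norm_scal_eq (V := X)), Rabs_Ropp, Rabs_pos_eq by lra.
  apply Rle_lt_trans with (e / 2 / (norm y + 1) * (norm y + 1)); [nra|].
  replace (e / 2 / (norm y + 1) * (norm y + 1)) with (e / 2) by (field; lra); lra.
Qed.

Lemma cone_antisym x : K x -> K (scal (-1) x) -> x = zero.
Proof.
  intros H1 H2; apply (cone_pointed K HK); [easy|].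
  replace (opp x) with (scal (-1) x) by vec X; easy.
Qed.

(** Iteration from zero never leaves [K], and a contraction has only one fixed point. *)
Lemma contraction_in_cone (f : X -> X) (c : R) y :
  0 <= c < 1 -> (forall a b, norm (minus (f a) (f b)) <= c * norm (minus a b)) ->
  (forall x, K x -> K (f x)) -> f y = y -> K y.
Proof.
  intros Hc Hf HKf Hy.
  destruct (contraction_fixed_point (Banach_seq_complete X) f c K zero Hc Hf
    (cone_closed K HK) (cone_zero K HK) HKf) as (x & Hx & Hfx).
  replace y with x; [easy|].
  assert (H := Hf x y); rewrite Hfx, Hy in H.
  assert (N := norm_nonneg (V := X) (minus x y)).
  assert (E : forall n, 0 <= n -> n <= c * n -> n <= 0) by (intros; nra).
  apply (norm_minus_0 (V := X)); exact (E _ N H).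
Qed.

(** * Positivity of the resolvent on the real axis *)

Context (T : X -> X) (HT : is_linear T) (p : R) (Hp0 : 0 <= p)
  (Hp : forall v, K v -> K (shift T p v)).

(** Positivity of [(l - T)^-1], phrased so that it can be stated before [l - T] is known to be
    invertible. *)
Definition resolvent_positive (l : R) : Prop :=
  forall y, K (minus (scal l y) (T y)) -> K y.

(** With [x = (l - T) y], the vector [y] is fixed by [z |-> (x + (T + p) z) / (l + p)], which
    preserves [K] and contracts for large [l]. *)
Lemma resolvent_positive_large : exists B, forall l, B <= l -> resolvent_positive l.
Proof.
  destruct (linear_norm _ (is_linear_shift T p HT)) as (M & HM & HMb).
  exists (2 * M); intros l Hl y Hx; set (x := minus (scal l y) (T y)) in *.
  assert (Hlp : 0 < l + p) by lra.
  apply (contraction_in_cone (fun z => scal (/ (l + p)) (plus x (shift T p z))) (/ 2)); [lra| | |].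
  - intros a b.
    norm_as X (scal (/ (l + p)) (minus (shift T p a) (shift T p b))).
    rewrite <- (lin_minus _ (is_linear_shift T p HT)).
    rewrite (norm_scal_eq (V := X)), Rabs_pos_eq by (apply Rlt_le, Rinv_0_lt_compat, Hlp).
    apply Rle_trans with (/ (l + p) * (M * norm (minus a b))).
    + apply Rmult_le_compat_l; [apply Rlt_le, Rinv_0_lt_compat, Hlp|apply HMb].
    + rewrite <- Rmult_assoc; apply Rmult_le_compat_r; [apply (norm_nonneg (V := X))|].
      apply Rmult_le_reg_l with (l + p); [easy|].
      rewrite <- Rmult_assoc, Rinv_r by lra; lra.
  - intros z Hz; apply (cone_scal K HK); [apply Rlt_le, Rinv_0_lt_compat, Hlp|].
    apply (cone_plus K HK); auto.
  - unfold x, shift; vec_eq X; field; lra.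
Qed.

(** Rewriting [(mu - T) y = x] as [y = Q (x + (l - mu) y)] gives a contraction that preserves [K],
    because [Q] does. *)
Lemma resolvent_positive_left l mu Q M :
  (forall x, minus (scal l (Q x)) (T (Q x)) = x) ->
  (forall x, Q (minus (scal l x) (T x)) = x) -> is_linear Q ->
  (forall x, norm (Q x) <= M * norm x) -> mu <= l -> (l - mu) * M <= / 2 ->
  resolvent_positive l -> resolvent_positive mu.
Proof.
  intros Q1 Q2 HQ HM Hmu HlM Hl y Hx; set (x := minus (scal mu y) (T y)) in *.
  apply (contraction_in_cone (fun z => Q (plus x (scal (l - mu) z))) (/ 2)); [lra| | |].
  - intros a b.
    assert (E : minus (Q (plus x (scal (l - mu) a))) (Q (plus x (scal (l - mu) b))) =
      scal (l - mu) (Q (minus a b))).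
    { rewrite <- (lin_scal Q HQ); etransitivity; [symmetry; apply (lin_minus Q HQ)|].
      f_equal; vec X. }
    eapply Rle_trans; [right; apply (f_equal (norm (V := X)) E)|].
    rewrite (norm_scal_eq (V := X)), Rabs_pos_eq by lra.
    apply Rle_trans with ((l - mu) * (M * norm (minus a b))).
    + apply Rmult_le_compat_l; [lra|apply HM].
    + rewrite <- Rmult_assoc; apply Rmult_le_compat_r; [apply (norm_nonneg (V := X))|easy].
  - intros z Hz; apply Hl; rewrite Q1; apply (cone_plus K HK); [easy|].
    apply (cone_scal K HK); [lra|easy].
  - rewrite <- (Q2 y) at 2; f_equal; unfold x; vec X.
Qed.

(** The supremum [s] of the failures still lies to the right of the spectrum. Positivity at a point
    just beyond [s] therefore reaches a fixed distance below [s], where failures remain. *)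
Lemma resolvent_positive_right_of_spectrum l : spectral_radius T < l -> resolvent_positive l.
Proof.
  intros Hl0; apply NNPP; intros Hn.
  set (r := spectral_radius T) in *.
  assert (Hres : forall l, r < l -> ~ spectrum T (RtoC l)).
  { intros l1 H1 H2; apply (spectrum_le_radius T HT) in H2; rewrite Cmod_R in H2.
    generalize (Rle_abs l1); fold r in H2; lra. }
  destruct resolvent_positive_large as [B HB].
  destruct (completeness (fun mu => r < mu /\ ~ resolvent_positive mu)) as [s [Hs1 Hs2]].
  { exists B; intros mu [_ H]; apply Rnot_lt_le; intros h; apply H, HB; lra. }
  { now exists l. }
  assert (Hs : r < s) by (generalize (Hs1 l (conj Hl0 Hn)); lra).
  destruct (real_resolvent T HT s (Hres s Hs)) as (Q & HQ & Q1 & Q2).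
  destruct (linear_norm Q HQ) as (M & HM & HMb).
  (* The resolvent at [s + eta] is bounded by [2 * M], and a failure [mu] lies within [2 * eta] of
     that point: [2 * eta * (2 * M) = 1/2] is what [resolvent_positive_left] allows. *)
  set (eta := / (8 * M)).
  assert (Heta : 0 < eta) by (apply Rinv_0_lt_compat; lra).
  assert (HeM : eta * M = / 8) by (unfold eta; field; lra).
  destruct (real_resolvent T HT (s + eta) (Hres (s + eta) ltac:(lra))) as (Q' & HQ' & Q1' & Q2').
  assert (HMb' : forall x, norm (Q' x) <= 2 * M * norm x).
  { intros x; set (y := Q' x).
    assert (Hy : y = Q (plus x (scal (- eta) y))).
    { rewrite <- (Q2 y) at 1; f_equal; rewrite <- (Q1' x) at 1; fold y; vec X. }
    assert (H := HMb (plus x (scal (- eta) y))); rewrite <- Hy in H.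
    assert (H2 : norm (plus x (scal (- eta) y)) <= norm x + eta * norm y).
    { eapply Rle_trans; [apply (norm_triangle (V := X))|].
      rewrite (norm_scal_eq (V := X)), Rabs_Ropp, Rabs_pos_eq; lra. }
    generalize (norm_nonneg (V := X) y) (norm_nonneg (V := X) x); intros.
    assert (M * norm (plus x (scal (- eta) y)) <= M * norm x + / 8 * norm y)
      by (rewrite <- HeM; nra).
    nra. }
  assert (Hpos : resolvent_positive (s + eta)).
  { apply NNPP; intros h; generalize (Hs1 (s + eta) (conj (Rlt_trans _ _ (s + eta) Hs ltac:(lra)) h)); lra. }
  assert (Hmu : exists mu, s - eta < mu /\ r < mu /\ ~ resolvent_positive mu).
  { apply NNPP; intros h; assert (s <= s - eta); [|lra].
    apply Hs2; intros mu [h1 h2]; apply Rnot_lt_le; intros h3; apply h; now exists mu. }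
  destruct Hmu as (mu & H1 & H2 & H3); apply H3.
  assert (H4 := Hs1 mu (conj H2 H3)).
  apply (resolvent_positive_left (s + eta) mu Q' (2 * M)); auto; nra.
Qed.

(* The limit of [(l - r) (l I - T)^-1 x] as [l] decreases to [r] is [f x a]. *)
Lemma spectral_projection_positive (a : X) (f : X -> R) (G : X -> X) x :
  functional f -> is_linear G ->
  (forall x, f (shift T (- spectral_radius T) x) = 0) ->
  (forall x, G (shift T (- spectral_radius T) x) = minus x (scal (f x) a)) ->
  K x -> K (scal (f x) a).
Proof.
  intros Hf HG Hf0 HGT Hx; set (r := spectral_radius T) in *.
  destruct (linear_norm G HG) as (N & HN & HNb).
  set (C := N * (2 * norm (scal (f x) a) + 2 * norm x) + 1).
  assert (Na := norm_nonneg (V := X) (scal (f x) a)).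
  assert (Nx := norm_nonneg (V := X) x).
  assert (HC : 0 < C) by (unfold C; nra).
  apply (closed_approx (V := X) K _ (cone_closed K HK)); intros eps He.
  (* The first bound lets [norm z] be absorbed when it is estimated through itself; the second makes
     the final error smaller than [eps]. *)
  set (e := Rmin (/ (2 * N)) (eps / (2 * C))).
  assert (He0 : 0 < e) by (apply Rmin_pos; [apply Rinv_0_lt_compat|apply Rdiv_lt_0_compat]; lra).
  assert (HeN : e * N <= / 2).
  { apply Rle_trans with (/ (2 * N) * N); [apply Rmult_le_compat_r; [lra|apply Rmin_l]|].
    right; field; lra. }
  assert (HeC : e * C < eps).
  { apply Rle_lt_trans with (eps / (2 * C) * C); [apply Rmult_le_compat_r; [lra|apply Rmin_r]|].
    replace (eps / (2 * C) * C) with (eps / 2) by (field; lra); lra. }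
  assert (Hns : ~ spectrum T (RtoC (r + e))).
  { intros H; apply (spectrum_le_radius T HT) in H; rewrite Cmod_R in H; fold r in H.
    generalize (Rle_abs (r + e)); lra. }
  destruct (real_resolvent T HT (r + e) Hns) as (Q & _ & Q1 & _).
  set (y := Q x); set (z := scal e y).
  assert (Ty : shift T (- r) y = minus (scal e y) x).
  { unfold shift; rewrite <- (Q1 x) at 1; fold y; vec X. }
  assert (fy : e * f y = f x).
  { generalize (Hf0 y); rewrite Ty, (fun_minus f Hf), (fun_scal f Hf); lra. }
  (* This is [G (T - r) y = y - f y a] multiplied by [e]: the distance to the limit carries a factor
     [e]. *)
  assert (Hz : minus z (scal (f x) a) = scal e (G (minus z x))).
  { unfold z at 2; rewrite <- Ty, HGT, <- fy; unfold z; vec X. }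
  assert (Hzx : norm (G (minus z x)) <= N * (norm z + norm x)).
  { eapply Rle_trans; [apply HNb|]; apply Rmult_le_compat_l; [lra|].
    apply (norm_minus_triangle (V := X)). }
  assert (Hn : norm (minus z (scal (f x) a)) <= e * (N * (norm z + norm x))).
  { rewrite Hz, (norm_scal_eq (V := X)), Rabs_pos_eq by lra; apply Rmult_le_compat_l; [lra|easy]. }
  assert (Nz := norm_nonneg (V := X) z).
  assert (Hz2 : norm z <= 2 * norm (scal (f x) a) + norm x).
  { assert (norm z <= norm (minus z (scal (f x) a)) + norm (scal (f x) a)).
    { eapply Rle_trans; [|apply (norm_triangle (V := X))]; right; f_equal; vec X. }
    assert (e * (N * (norm z + norm x)) <= / 2 * (norm z + norm x)) by nra.
    lra. }
  exists z; split.
  - apply (cone_scal K HK); [lra|].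
    apply (resolvent_positive_right_of_spectrum (r + e)); [fold r; lra|].
    unfold y; now rewrite Q1.
  - eapply Rle_lt_trans; [apply Hn|]; eapply Rle_lt_trans; [|apply HeC].
    apply Rmult_le_compat_l; [lra|]; unfold C.
    assert (N * (norm z + norm x) <= N * (2 * norm (scal (f x) a) + 2 * norm x))
      by (apply Rmult_le_compat_l; lra).
    lra.
Qed.

End Cone.

Lemma principal_splitting {X : Banach} (K : X -> Prop) (T : X -> X) :
  special_cone K -> M_amenable K T ->
  exists (phi : X) (f : X -> R) (G : X -> X),
    interior K phi /\ T phi = scal (spectral_radius T) phi /\
    functional f /\ (forall v, K v -> 0 <= f v) /\ f phi = 1 /\ is_linear G /\
    (forall x, f (T_r T x) = 0) /\
    (forall x, T_r T (G x) = minus x (scal (f x) phi)) /\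
    (forall x, G (T_r T x) = minus x (scal (f x) phi)).
Proof.
  intros (HK & _ & Hgen & _) [HT Hel (p & Hp0 & Hp)].
  assert (Hp' : forall v, K v -> K (shift T p v)).
  { intros v Hv; destruct (classic (v = zero)) as [->|H].
    - rewrite (lin_zero _ (is_linear_shift T p HT)); apply (cone_zero K HK).
    - apply (interior_in K), Hp; auto. }
  assert (Hr : 0 <= spectral_radius T).
  { eapply Rle_trans; [apply Cmod_ge_0|]; apply (spectrum_le_radius T HT), (proj1 Hel). }
  destruct (elementary_splitting T _ HT Hel) as (a & f & G & Ha0 & Ha & Hf & Hfa & HG & H1 & H2 & H3).
  assert (Hpos := fun x => spectral_projection_positive K HK T HT p Hp0 Hp' a f G x Hf HG H1 H3).
  unfold T_r; set (r := spectral_radius T) in *.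
  (* [f] cannot vanish on a generating cone, since [f a = 1]. *)
  assert (Hx : exists x, K x /\ f x <> 0).
  { destruct (Hgen a) as (u & w & Hu & Hw & Huw).
    destruct (Req_dec (f u) 0) as [Hu0|]; [|now exists u].
    exists w; split; [easy|]; rewrite Huw, (fun_minus f Hf) in Hfa; lra. }
  destruct Hx as (x0 & Hx0 & Hfx0); set (c := f x0) in *; set (phi := scal c a).
  assert (Hphi : K phi) by now apply Hpos.
  assert (Hphi0 : phi <> zero).
  { intros h; apply Ha0; replace a with (scal (/ c) phi) by (unfold phi; vec_eq X; field; easy).
    rewrite h; vec X. }
  assert (HTphi : T phi = scal r phi) by (unfold phi; rewrite (lin_scal T HT), Ha; vec X).
  (* [T + p] sends [phi] to [(r + p) phi], which is therefore interior. The case [r + p = 0] would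
     put zero in the interior and hence [- phi] in [K]. *)
  assert (Hint : interior K phi).
  { assert (H := Hp phi Hphi Hphi0).
    assert (E : shift T p phi = scal (r + p) phi) by (unfold shift; rewrite HTphi; vec X).
    rewrite E in H.
    destruct (Rle_lt_or_eq_dec 0 (r + p) ltac:(lra)) as [h|h].
    - replace phi with (scal (/ (r + p)) (scal (r + p) phi)) by (vec_eq X; field; lra).
      apply (interior_scal K HK); [now apply Rinv_0_lt_compat|easy].
    - exfalso; apply Hphi0, (cone_antisym K HK); [easy|].
      destruct (interior_minus_small K _ phi H) as (e & He & Hk).
      replace (scal (-1) phi) with (scal (/ e) (minus (scal (r + p) phi) (scal e phi)))
        by (rewrite <- h; vec_eq X; field; lra).
      apply (cone_scal K HK); [now apply Rlt_le, Rinv_0_lt_compat|easy]. }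
  exists phi, (fun x => / c * f x), G.
  assert (E : forall x, scal (/ c * f x) phi = scal (f x) a)
    by (intros x; unfold phi; vec_eq X; field; easy).
  repeat split; auto.
  - intros x y; change (/ c * f (plus x y) = / c * f x + / c * f y); rewrite (fun_plus f Hf); ring.
  - intros k x; change (/ c * f (scal k x) = k * (/ c * f x)); rewrite (fun_scal f Hf); ring.
  - destruct (fun_bound f Hf) as (M & HM & HMb).
    exists (Rabs (/ c) * M); split.
    + apply Rmult_lt_0_compat; [apply Rabs_pos_lt, Rinv_neq_0_compat; easy|easy].
    + intros x; change (Rabs (/ c * f x) <= Rabs (/ c) * M * norm x).
      rewrite Rabs_mult, Rmult_assoc; apply Rmult_le_compat_l; [apply Rabs_pos|apply HMb].
  (* A negative value [k] would give [scal k phi] in [K], hence [- phi] in [K]. *)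
  - intros v Hv; apply Rnot_lt_le; intros h; apply Hphi0, (cone_antisym K HK); [easy|].
    assert (Hk := Hpos v Hv); rewrite <- E in Hk.
    generalize dependent (/ c * f v); intros k h Hk.
    replace (scal (-1) phi) with (scal (/ - k) (scal k phi)) by (vec_eq X; field; lra).
    apply (cone_scal K HK); [apply Rlt_le, Rinv_0_lt_compat; lra|easy].
  - unfold phi; rewrite (fun_scal f Hf), Hfa; field; easy.
  - apply HG.
  - apply HG.
  - apply HG.
  - intros x; rewrite H1; ring.
  - intros x; now rewrite E, H2.
  - intros x; now rewrite E, H3.
Qed.

(** * Comparison of consecutive chords *)

Lemma interior_near {X : Banach} (K : X -> Prop) x : interior K x ->
  exists eps, 0 < eps /\ forall d : X, norm d < eps -> interior K (plus x d).
Proof.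
  intros H; apply interior_iff in H; destruct H as (e & He & H).
  exists (e / 2); split; [lra|]; intros d Hd; apply interior_iff; exists (e / 2).
  split; [lra|]; intros y Hy; apply H.
  assert (H1 : norm (minus y x) <= norm (minus y (plus x d)) + norm (minus (plus x d) x))
    by apply (norm_chain (V := X)).
  assert (H2 : norm (minus (plus x d) x) = norm d) by (f_equal; vec X).
  lra.
Qed.

Lemma functional_interior_pos {X : Banach} (K : X -> Prop) (f : X -> R) phi v :
  functional f -> (forall v, K v -> 0 <= f v) -> f phi = 1 -> interior K v -> 0 < f v.
Proof.
  intros Hf Hpos Hphi Hv; destruct (interior_minus_small K v phi Hv) as (e & He & Hk).
  apply Hpos in Hk; rewrite (fun_minus f Hf), (fun_scal f Hf), Hphi in Hk; lra.
Qed.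

(** Positivity of [f] bounds the admissible multiples by [f v1 / f v2], and the supremum is attained
    because [K] is closed. *)
Lemma cone_maximal_step {X : Banach} (K : X -> Prop) (f : X -> R) v1 v2 :
  cone K -> functional f -> (forall v, K v -> 0 <= f v) -> 0 < f v2 -> K v1 ->
  exists s, 0 <= s /\ K (minus v1 (scal s v2)) /\
    forall e, 0 < e -> ~ K (minus (minus v1 (scal s v2)) (scal e v2)).
Proof.
  intros HK Hf Hpos Hv2 Hv1.
  destruct (completeness (fun s => K (minus v1 (scal s v2)))) as [s [Hs1 Hs2]].
  - exists (f v1 / f v2); intros s Hs; apply Hpos in Hs.
    rewrite (fun_minus f Hf), (fun_scal f Hf) in Hs.
    apply Rle_div_r; lra.
  - exists 0; replace (minus v1 (scal 0 v2)) with v1 by vec X; easy.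
  - exists s; repeat split.
    + apply Hs1; replace (minus v1 (scal 0 v2)) with v1 by vec X; easy.
    + assert (N := norm_nonneg (V := X) v2).
      apply (closed_approx (V := X) K _ (cone_closed K HK)); intros eps He.
      assert (He' : 0 < eps / (norm v2 + 1)) by (apply Rdiv_lt_0_compat; lra).
      assert (H : exists t, K (minus v1 (scal t v2)) /\ s - eps / (norm v2 + 1) < t).
      { apply NNPP; intros h; assert (s <= s - eps / (norm v2 + 1)); [|lra].
        apply Hs2; intros t Ht; apply Rnot_lt_le; intros h'; apply h; now exists t. }
      destruct H as (t & Ht & Hst); assert (Hts := Hs1 t Ht).
      exists (minus v1 (scal t v2)); split; [easy|].
      norm_as X (scal (s - t) v2).
      rewrite (norm_scal_eq (V := X)), Rabs_pos_eq by lra.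
      apply Rle_lt_trans with ((s - t) * (norm v2 + 1)); [nra|].
      apply Rlt_div_r; lra.
    + intros e He Hk; assert (s + e <= s); [|lra].
      apply Hs1; replace (minus v1 (scal (s + e) v2)) with
        (minus (minus v1 (scal s v2)) (scal e v2)) by vec X; easy.
Qed.

(* A discrete form of the sign change of the principal eigenvalue of [DF] along
   a fibre.  With [A12], [A23] the averages of [DF] over the two chords,
   [A23 v1 = A12 v1 - B v1] where [B] is the positive average of differences of
   [DP]; were [k2 >= 0], comparing [v1] with the largest multiple of [v2] below
   it would contradict the strong positivity of [A23 + q I]. *)
Lemma chord_monotone {X : Banach} (K : X -> Prop) (T P : X -> X) (DP : X -> X -> X)
  (p : R) (phi : X) (f : X -> R) (u v1 v2 : X) (k1 k2 : R) :
  cone K -> is_linear T -> 0 <= p -> strongly_positive K (shift T p) ->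
  functional f -> (forall v, K v -> 0 <= f v) -> f phi = 1 -> K phi ->
  is_C1 P DP -> M_Pos K DP -> M_NT K DP ->
  interior K v1 -> interior K v2 ->
  minus (diff_map T P (plus u v1)) (diff_map T P u) = scal k1 phi ->
  minus (diff_map T P (plus (plus u v1) v2)) (diff_map T P (plus u v1)) = scal k2 phi ->
  k1 <= 0 -> k2 < 0.
Proof.
  intros HK HT Hp0 Hp Hf Hpos Hfphi Hphi HC1 (q & Hq & HPos) HNT Hv1 Hv2 HF1 HF2 Hk1.
  apply Rnot_le_lt; intros Hk2.
  assert (Hfi := fun v => functional_interior_pos K f phi v Hf Hpos Hfphi).
  destruct (cone_maximal_step K f v1 v2 HK Hf Hpos (Hfi _ Hv2) (interior_in K _ Hv1))
    as (s & Hs0 & Hw & Hmax).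
  set (w := minus v1 (scal s v2) : X) in *.
  assert (D1 := C1_mean_value P DP HC1 u v1).
  assert (D2 := C1_mean_value P DP HC1 (plus u v1) v2).
  set (u2 := plus u v1 : X) in *; set (u3 := plus u2 v2 : X) in *.
  destruct (ex_RInt_continuous (V := X) (fun s => DP (plus u2 (scal s v2)) v1) 0 1) as [d Dd].
  { intros t _; apply (C1_continuous_segment P DP HC1). }
  set (B := minus d (minus (P u2) (P u)) : X).
  (* At equal parameters the base points on the two chords differ by [t v2 + (1 - t) v1], which is
     interior, so (M-NT) applies to every [g t]. *)
  set (g := fun t : R => minus (DP (plus u2 (scal t v2)) v1) (DP (plus u (scal t v1)) v1) : X).
  assert (HB : is_RInt g 0 1 B) by exact (is_RInt_minus _ _ _ _ _ _ Dd D1).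
  assert (Hg : forall t, 0 <= t <= 1 -> interior K (g t)).
  { intros t Ht; apply (HNT (plus u2 (scal t v2)) (plus u (scal t v1))).
    - replace (minus (plus u2 (scal t v2)) (plus u (scal t v1)))
        with (plus (scal t v2) (scal (1 - t) v1)) by (unfold u2; vec X).
      destruct (Req_dec t 0) as [->|Ht0].
      + replace (plus (scal 0 v2) (scal (1 - 0) v1)) with v1 by vec X; easy.
      + apply (interior_plus K HK); [apply (interior_scal K HK); [lra|easy]|].
        apply (cone_scal K HK); [lra|now apply interior_in].
    - now apply interior_in.
    - intros h; generalize (Hfi _ Hv1); rewrite h, (fun_zero f Hf); lra. }
  assert (KB : K B).
  { apply (is_RInt_cone K g 0 1 B HK Rlt_0_1); [|easy].
    intros t Ht; now apply interior_in, Hg. }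
  (* The strict sign is what excludes [w = 0] below. *)
  assert (fB : 0 < f B).
  { assert (H := is_RInt_linear (V := X) (W := R_NormedModule) f g 0 1 B Hf HB).
    rewrite <- (is_RInt_unique _ _ _ _ H); apply RInt_gt_0; [lra| |].
    - intros t Ht; apply Hfi, Hg; lra.
    - intros t _; apply (continuous_comp g f); [|apply (linear_cont f _ Hf)].
      apply (continuous_minus (V := X)); apply (C1_continuous_segment P DP HC1). }
  set (Dw := minus d (scal s (minus (P u3) (P u2))) : X).
  assert (HDw : is_RInt (fun t => DP (plus u2 (scal t v2)) w) 0 1 Dw).
  { assert (H := is_RInt_minus _ _ _ _ _ _ Dd (is_RInt_scal _ _ _ s _ D2)).
    revert H; apply is_RInt_ext; intros t _; unfold w.
    rewrite (lin_minus _ (C1_linear P DP HC1 _)), (lin_scal _ (C1_linear P DP HC1 _)); easy. }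
  assert (KD : K (minus (scal q w) Dw)).
  { assert (H := is_RInt_minus _ _ _ _ _ _ (is_RInt_const (V := X) 0 1 (scal q w)) HDw).
    replace (minus (scal q w) Dw) with (minus (scal (1 - 0) (scal q w)) Dw) by vec X.
    apply (is_RInt_cone K _ 0 1 _ HK Rlt_0_1) with (2 := H).
    intros t _; apply (HPos _ w Hw). }
  (* This is [Dw - T w], where [Dw] is the average of [DP] over the second chord applied to [w]; the
     signs of [k1], [k2] and [s] put it in [K]. *)
  set (A := plus B (scal (s * k2 - k1) phi) : X).
  assert (KA : K A).
  { apply (cone_plus K HK); [easy|]; apply (cone_scal K HK); [|easy].
    assert (0 <= s * k2) by now apply Rmult_le_pos. lra. }
  assert (EA : minus Dw (T w) = A).
  { unfold A, B, Dw, w; rewrite (lin_minus T HT), (lin_scal T HT).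
    assert (E1 : minus (T v1) (minus (P u2) (P u)) = scal k1 phi).
    { rewrite <- HF1; unfold diff_map, u2; rewrite (lin_plus T HT); vec X. }
    assert (E2 : minus (T v2) (minus (P u3) (P u2)) = scal k2 phi).
    { rewrite <- HF2; unfold diff_map, u3; rewrite (lin_plus T HT); vec X. }
    transitivity (plus (minus d (minus (P u2) (P u)))
      (minus (scal s (scal k2 phi)) (scal k1 phi))); [rewrite <- E1, <- E2|]; vec X. }
  destruct (classic (w = zero)) as [Hw0|Hw0].
  - assert (HA0 : f A = 0).
    { rewrite <- EA; assert (H : Dw = zero).
      { apply (is_RInt_unique (V := X)) in HDw; rewrite <- HDw.
        etransitivity; [apply RInt_ext; intros t _; rewrite Hw0;
          apply (lin_zero _ (C1_linear P DP HC1 _))|].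
        rewrite (is_RInt_unique _ _ _ _ (is_RInt_const (V := X) _ _ _)); vec X. }
      rewrite H, Hw0, (lin_zero T HT), (fun_minus f Hf), (fun_zero f Hf); ring. }
    unfold A in HA0; rewrite (fun_plus f Hf), (fun_scal f Hf), Hfphi in HA0.
    assert (0 <= s * k2) by now apply Rmult_le_pos. lra.
  - assert (Hi : interior K w).
    (* [(p + q) w = (T + p) w + (q w - Dw) + (Dw - T w)]: the first term is interior and the others
       lie in [K], so a further multiple of [v2] could be subtracted from [w]. *)
    { replace w with (scal (/ (p + q)) (plus (shift T p w) (plus (minus (scal q w) Dw) A)))
        by (rewrite <- EA; unfold shift; vec_eq X; field; lra).
      apply (interior_scal K HK); [apply Rinv_0_lt_compat; lra|].
      apply (interior_plus K HK); [now apply Hp|now apply (cone_plus K HK)]. }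
    destruct (interior_minus_small K w v2 Hi) as (e & He & Hk); exact (Hmax e He Hk).
Qed.

(** * Families of unimodal functions *)

Definition jointly_continuous {W : UniformSpace} (h : W -> R -> R) : Prop :=
  forall w t, continuous (fun q : W * R => h (fst q) (snd q)) (w, t).

Lemma jointly_continuous_comp {U W : UniformSpace} (h : W -> R -> R) (a : U -> W) (b : U -> R) x :
  jointly_continuous h -> continuous a x -> continuous b x ->
  continuous (fun y => h (a y) (b y)) x.
Proof. intros Hh Ha Hb; apply (continuous_comp_2 a b h x Ha Hb), Hh. Qed.

Lemma continuous_R_minus {U : UniformSpace} (a b : U -> R) x :
  continuous a x -> continuous b x -> continuous (fun y => a y - b y) x.
Proof. exact (continuous_minus (V := R_NormedModule) a b x). Qed.

Lemma continuous_R_plus {U : UniformSpace} (a b : U -> R) x :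
  continuous a x -> continuous b x -> continuous (fun y => a y + b y) x.
Proof. exact (continuous_plus (V := R_NormedModule) a b x). Qed.

Lemma continuous_Rmin {U : UniformSpace} (a b : U -> R) x :
  continuous a x -> continuous b x -> continuous (fun y => Rmin (a y) (b y)) x.
Proof.
  rewrite !continuous_R_iff; intros Ha Hb eps He.
  generalize (filter_and (F := locally x) _ _ (Ha eps He) (Hb eps He)); apply filter_imp.
  intros y [A B]; unfold Rmin; destruct (Rle_dec (a y) (b y)), (Rle_dec (a x) (b x));
    revert A B; unfold Rabs; repeat destruct Rcase_abs; lra.
Qed.

Lemma continuous_Rmax {U : UniformSpace} (a b : U -> R) x :
  continuous a x -> continuous b x -> continuous (fun y => Rmax (a y) (b y)) x.
Proof.
  rewrite !continuous_R_iff; intros Ha Hb eps He.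
  generalize (filter_and (F := locally x) _ _ (Ha eps He) (Hb eps He)); apply filter_imp.
  intros y [A B]; unfold Rmax; destruct (Rle_dec (a y) (b y)), (Rle_dec (a x) (b x));
    revert A B; unfold Rabs; repeat destruct Rcase_abs; lra.
Qed.

Lemma continuous_lt {U : UniformSpace} (a b : U -> R) x :
  continuous a x -> continuous b x -> a x < b x -> locally x (fun y => a y < b y).
Proof.
  rewrite !continuous_R_iff; intros Ha Hb Hlt.
  assert (He : 0 < (b x - a x) / 2) by lra.
  generalize (filter_and (F := locally x) _ _ (Ha _ He) (Hb _ He)); apply filter_imp.
  intros y [A B]; revert A B; unfold Rabs; repeat destruct Rcase_abs; lra.
Qed.

Lemma jointly_continuous_fix {W : UniformSpace} (h : W -> R -> R) t w :
  jointly_continuous h -> continuous (fun w => h w t) w.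
Proof.
  intros Hh; apply (jointly_continuous_comp h (fun w => w) (fun _ => t)); auto.
  - apply continuous_id.
  - apply continuous_const.
Qed.

Lemma jointly_continuous_line {W : UniformSpace} (h : W -> R -> R) w t :
  jointly_continuous h -> continuous (h w) t.
Proof.
  intros Hh; apply (jointly_continuous_comp h (fun _ => w) (fun t => t)); auto.
  - apply continuous_const.
  - apply continuous_id.
Qed.

(** With [t = theta w s], the inequalities [tau w (t - eps) < s < tau w (t + eps)] are open in
    [(w, s)] and, by monotonicity, trap the inverse. *)
Lemma increasing_family_inverse {W : UniformSpace} (tau : W -> R -> R) :
  jointly_continuous tau -> (forall w t1 t2, t1 < t2 -> tau w t1 < tau w t2) ->
  (forall w s, exists t, tau w t = s) ->
  exists theta : W -> R -> R, jointly_continuous theta /\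
    (forall w s, tau w (theta w s) = s) /\ (forall w t, theta w (tau w t) = t).
Proof.
  intros Hc Hi Hs.
  destruct (choice (fun (q : W * R) t => tau (fst q) t = snd q) (fun q => Hs (fst q) (snd q)))
    as [th Hth].
  assert (Hmono : forall w t1 t2, tau w t1 < tau w t2 -> t1 < t2).
  { intros w t1 t2 H; destruct (Rlt_or_le t1 t2) as [|[h|h]]; [easy| |].
    - generalize (Hi w _ _ h); lra.
    - rewrite h in H; lra. }
  exists (fun w s => th (w, s)); repeat split.
  - intros w s; apply continuous_R_iff; intros eps He.
    set (t := th (w, s)).
    assert (Ht : tau w t = s) by apply (Hth (w, s)).
    assert (A : locally (w, s) (fun q : W * R => tau (fst q) (t - eps) < snd q)).
    { apply (continuous_lt (fun q : W * R => tau (fst q) (t - eps)) snd (w, s)).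
      - apply (continuous_comp fst (fun w => tau w (t - eps))); [apply continuous_fst|].
        now apply jointly_continuous_fix.
      - apply continuous_snd.
      - change (tau w (t - eps) < s); rewrite <- Ht; apply Hi; lra. }
    assert (B : locally (w, s) (fun q : W * R => snd q < tau (fst q) (t + eps))).
    { apply (continuous_lt snd (fun q : W * R => tau (fst q) (t + eps)) (w, s)).
      - apply continuous_snd.
      - apply (continuous_comp fst (fun w => tau w (t + eps))); [apply continuous_fst|].
        now apply jointly_continuous_fix.
      - change (s < tau w (t + eps)); rewrite <- Ht; apply Hi; lra. }
    generalize (filter_and (F := locally (w, s)) _ _ A B); apply filter_imp.
    intros [w' s'] [H1 H2]; assert (E := Hth (w', s')); simpl in *; rewrite <- E in H1, H2.
    apply Hmono in H1; apply Hmono in H2; apply Rabs_def1; fold t; lra.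
  - intros w s; apply (Hth (w, s)).
  - intros w t; assert (H := Hth (w, tau w t)); simpl in H.
    destruct (Rtotal_order (th (w, tau w t)) t) as [h|[h|h]]; [|easy|];
      generalize (Hi w _ _ h); lra.
Qed.

Lemma linear_bounds_maximum (g : R -> R) (a1 b1 a2 b2 : R) :
  (forall t, continuous g t) -> 0 < a1 -> 0 < a2 ->
  (forall t, g t <= a1 * t + b1) -> (forall t, g t <= b2 - a2 * t) ->
  exists m, forall t, g t <= g m.
Proof.
  intros Hc Ha1 Ha2 H1 H2.
  (* The affine majorants take the value [g 0] at [x1] and [x2]; beyond these points [g] cannot
     exceed [g 0], so a maximum over a compact interval containing 0, [x1] and [x2] is global. *)
  set (x1 := (g 0 - b1) / a1); set (x2 := (b2 - g 0) / a2).
  assert (E1 : a1 * x1 = g 0 - b1) by (unfold x1; field; lra).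
  assert (E2 : a2 * x2 = b2 - g 0) by (unfold x2; field; lra).
  clearbody x1 x2; set (A := Rabs x1 + Rabs x2).
  assert (HA1 := Rabs_pos x1); assert (HA2 := Rabs_pos x2).
  assert (HA3 := Rabs_maj2 x1); assert (HA4 := Rle_abs x2).
  destruct (continuity_ab_maj g (- A) A) as (m & Hm & Hm').
  - unfold A; lra.
  - intros t _; apply continuity_pt_filterlim, Hc.
  - exists m; intros t.
    assert (H0 : g 0 <= g m) by (apply Hm; unfold A; lra).
    destruct (Rlt_or_le t (- A)) as [h|h]; [|destruct (Rlt_or_le A t) as [h'|h']].
    + assert (t <= x1) by (unfold A in h; lra); specialize (H1 t); nra.
    + assert (x2 <= t) by (unfold A in h'; lra); specialize (H2 t); nra.
    + now apply Hm.
Qed.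

(* [tau w t] is [h w (m w) - h w t] with the sign of [t - m w], where [m w] is
   the maximizer; written with [Rmin] and [Rmax] it is visibly continuous. *)
Lemma unimodal_family_fold {W : UniformSpace} (h : W -> R -> R) (a1 b1 a2 b2 : R) :
  jointly_continuous h -> 0 < a1 -> 0 < a2 ->
  (forall w t, h w t <= a1 * t + b1) -> (forall w t, h w t <= b2 - a2 * t) ->
  (forall w t1 t2 t3, t1 < t2 -> t2 < t3 -> h w t2 <= h w t1 -> h w t3 < h w t2) ->
  exists (M : W -> R) (tau theta : W -> R -> R),
    (forall w, continuous M w) /\ jointly_continuous tau /\ jointly_continuous theta /\
    (forall w s, tau w (theta w s) = s) /\ (forall w t, theta w (tau w t) = t) /\
    (forall w t, h w t = M w - Rabs (tau w t)).
Proof.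
  intros Hc Ha1 Ha2 H1 H2 Hu.
  destruct (choice (fun w m => forall t, h w t <= h w m)) as [m Hm].
  { intros w; apply (linear_bounds_maximum (h w) a1 b1 a2 b2); auto.
    intros t; now apply jointly_continuous_line. }
  assert (Hright : forall w t1 t2, m w <= t1 -> t1 < t2 -> h w t2 < h w t1).
  { assert (Hr0 : forall w t1 t2, m w < t1 -> t1 < t2 -> h w t2 < h w t1).
    { intros w t1 t2 h1 h2; apply (Hu w (m w)); auto. }
    (* The three-point hypothesis starts at [m w], so strict decrease from [m w] itself passes
       through a midpoint. *)
    intros w t1 t2 [h1|<-] h2; [now apply Hr0|].
    apply Rlt_le_trans with (h w ((m w + t2) / 2)); [apply Hr0; lra|apply Hm]. }
  assert (Hleft : forall w t1 t2, t2 <= m w -> t1 < t2 -> h w t1 < h w t2).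
  { assert (Hl0 : forall w t1 t2, t2 < m w -> t1 < t2 -> h w t1 < h w t2).
    { intros w t1 t2 h1 h2; apply Rnot_le_lt; intros h3.
      generalize (Hu w t1 t2 (m w) h2 h1 h3) (Hm w t2); lra. }
    intros w t1 t2 [h1| ->] h2; [now apply Hl0|].
    apply Rlt_le_trans with (h w ((t1 + m w) / 2)); [apply Hl0; lra|apply Hm]. }
  (* For [w'] near [w] the value at [m w] still exceeds those at [m w - eps] and [m w + eps], and
     monotonicity on each side of [m w'] confines [m w'] between them. *)
  assert (Hmc : forall w, continuous m w).
  { intros w; apply continuous_R_iff; intros eps He.
    assert (A := continuous_lt _ _ w (jointly_continuous_fix h (m w + eps) w Hc)
      (jointly_continuous_fix h (m w) w Hc) (Hright w (m w) (m w + eps) ltac:(lra) ltac:(lra))).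
    assert (B := continuous_lt _ _ w (jointly_continuous_fix h (m w - eps) w Hc)
      (jointly_continuous_fix h (m w) w Hc) (Hleft w (m w - eps) (m w) ltac:(lra) ltac:(lra))).
    generalize (filter_and (F := locally w) _ _ A B); apply filter_imp; intros w' [h1 h2].
    apply Rabs_def1; apply Rnot_le_lt; intros h3.
    - generalize (Hleft w' (m w) (m w + eps) ltac:(lra) ltac:(lra)); lra.
    - generalize (Hright w' (m w - eps) (m w) ltac:(lra) ltac:(lra)); lra. }
  set (tau := fun w t => h w (Rmin t (m w)) - h w (Rmax t (m w))).
  assert (Htc : jointly_continuous tau).
  { intros w t; unfold tau.
    assert (Cm : continuous (fun q : W * R => m (fst q)) (w, t)).
    { apply (continuous_comp fst m); [apply continuous_fst|apply Hmc]. }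
    apply (continuous_R_minus (fun q : W * R => h (fst q) (Rmin (snd q) (m (fst q))))
      (fun q : W * R => h (fst q) (Rmax (snd q) (m (fst q)))));
      apply jointly_continuous_comp; auto using continuous_fst.
    - apply (continuous_Rmin snd (fun q : W * R => m (fst q))); auto using continuous_snd.
    - apply (continuous_Rmax snd (fun q : W * R => m (fst q))); auto using continuous_snd. }
  assert (Tr : forall w t, m w <= t -> tau w t = h w (m w) - h w t).
  { intros w t h1; unfold tau; rewrite Rmin_right, Rmax_left; lra. }
  assert (Tl : forall w t, t <= m w -> tau w t = h w t - h w (m w)).
  { intros w t h1; unfold tau; rewrite Rmin_left, Rmax_right; lra. }
  assert (Hti : forall w t1 t2, t1 < t2 -> tau w t1 < tau w t2).
  { intros w t1 t2 h1; destruct (Rle_or_lt (m w) t1); [|destruct (Rle_or_lt (m w) t2)].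
    - rewrite !Tr by lra; generalize (Hright w t1 t2); lra.
    - rewrite Tl, Tr by lra; generalize (Hleft w t1 (m w)) (Hm w t2); lra.
    - rewrite !Tl by lra; generalize (Hleft w t1 t2); lra. }
  assert (Hts : forall w s, exists t, tau w t = s).
  { intros w s; set (y := h w (m w)).
    (* At these two quotients the affine majorants force [tau] below and above [s]; the minimum and
       maximum with [m w] select the branch of [tau]. *)
    set (t1 := Rmin (m w) ((s + y - b1) / a1)); set (t2 := Rmax (m w) ((s - y + b2) / a2)).
    assert (h1 : t1 <= m w) by apply Rmin_l. assert (h2 : m w <= t2) by apply Rmax_l.
    assert (B1 : tau w t1 <= s).
    { rewrite Tl by easy; fold y.
      assert (a1 * t1 <= a1 * ((s + y - b1) / a1)) by (apply Rmult_le_compat_l; [lra|apply Rmin_r]).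
      replace (a1 * ((s + y - b1) / a1)) with (s + y - b1) in H by (field; lra).
      generalize (H1 w t1); lra. }
    assert (B2 : s <= tau w t2).
    { rewrite Tr by easy; fold y.
      assert (a2 * ((s - y + b2) / a2) <= a2 * t2) by (apply Rmult_le_compat_l; [lra|apply Rmax_r]).
      replace (a2 * ((s - y + b2) / a2)) with (s - y + b2) in H by (field; lra).
      generalize (H2 w t2); lra. }
    destruct (IVT_gen (tau w) t1 t2 s) as (t & _ & Ht).
    - intros t; apply continuity_pt_filterlim, (jointly_continuous_line tau w t Htc).
    - rewrite Rmin_left, Rmax_right; lra.
    - now exists t. }
  destruct (increasing_family_inverse tau Htc Hti Hts) as (theta & Hth & Hth1 & Hth2).
  exists (fun w => h w (m w)), tau, theta; repeat split; auto.
  - intros w; apply (jointly_continuous_comp h (fun w => w) m); auto using continuous_id.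
  - intros w t; destruct (Rle_or_lt (m w) t).
    + rewrite Tr by easy; rewrite Rabs_pos_eq; generalize (Hm w t); lra.
    + rewrite Tl by lra; rewrite Rabs_left1; generalize (Hm w t); lra.
Qed.

(** * The kernel of a functional *)

Section Kernel.
Context {X : Banach} (f : X -> R) (phi : X) (Hf : functional f) (Hphi : f phi = 1).

(** [fold] asks for a Banach space as a type of its own, so the kernel is a subtype whose whole
    structure is pulled back from [X]. *)
Definition kernel : Type := {x : X | f x = 0}.
Definition kernel_val (w : kernel) : X := proj1_sig w.

Lemma kernel_val_inj w1 w2 : kernel_val w1 = kernel_val w2 -> w1 = w2.
Proof.
  destruct w1 as [x Hx], w2 as [y Hy]; simpl; intros <-; f_equal; apply proof_irrelevance.
Qed.

Lemma kernel_proj_proof x : f (minus x (scal (f x) phi)) = 0.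
Proof. rewrite (fun_minus f Hf), (fun_scal f Hf), Hphi; ring. Qed.
Definition kernel_proj (x : X) : kernel := exist _ _ (kernel_proj_proof x).

Lemma kernel_proj_val w : kernel_proj (kernel_val w) = w.
Proof.
  apply kernel_val_inj; destruct w as [x Hx]; simpl; rewrite Hx; vec X.
Qed.

Lemma kernel_plus_proof (v w : kernel) : f (plus (kernel_val v) (kernel_val w)) = 0.
Proof.
  destruct v as [x Hx], w as [y Hy]; simpl; rewrite (fun_plus f Hf), Hx, Hy; ring.
Qed.
Lemma kernel_scal_proof (k : R) (w : kernel) : f (scal k (kernel_val w)) = 0.
Proof. destruct w as [x Hx]; simpl; rewrite (fun_scal f Hf), Hx; ring. Qed.

Definition kernel_plus (v w : kernel) : kernel := exist _ _ (kernel_plus_proof v w).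
Definition kernel_scal (k : R) (w : kernel) : kernel := exist _ _ (kernel_scal_proof k w).
Definition kernel_zero : kernel := exist _ zero (fun_zero f Hf).

Definition kernel_AbelianMonoid_mixin : AbelianMonoid.mixin_of kernel.
Proof.
  apply (AbelianMonoid.Mixin _ kernel_plus kernel_zero);
    intros; apply kernel_val_inj; simpl; vec X.
Defined.

Definition kernel_AbelianGroup_mixin :
  AbelianGroup.mixin_of (AbelianMonoid.Pack kernel kernel_AbelianMonoid_mixin kernel).
Proof.
  apply (AbelianGroup.Mixin (AbelianMonoid.Pack _ kernel_AbelianMonoid_mixin kernel)
    (kernel_scal (-1))).
  intros x; apply kernel_val_inj; simpl; vec X.
Defined.

Definition kernel_AbelianGroup_class :=
  AbelianGroup.Class kernel kernel_AbelianMonoid_mixin kernel_AbelianGroup_mixin.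

Definition kernel_ModuleSpace_mixin : ModuleSpace.mixin_of R_Ring
  (AbelianGroup.Pack kernel kernel_AbelianGroup_class kernel).
Proof.
  apply (ModuleSpace.Mixin R_Ring (AbelianGroup.Pack kernel kernel_AbelianGroup_class kernel)
    kernel_scal); intros; apply kernel_val_inj; simpl.
  - change (mult x y) with (x * y); vec X.
  - change (one : R) with 1; vec X.
  - vec X.
  - change (plus x y) with (x + y); vec X.
Defined.

Definition kernel_UniformSpace_mixin : UniformSpace.mixin_of kernel.
Proof.
  apply (UniformSpace.Mixin kernel kernel_zero
    (fun v e w => ball (kernel_val v) e (kernel_val w))).
  - intros; apply ball_center.
  - intros; now apply ball_sym.
  - intros; eapply ball_triangle; eauto.
Defined.

Definition kernel_NormedModuleAux_class : NormedModuleAux.class_of R_AbsRing kernel :=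
  NormedModuleAux.Class R_AbsRing kernel
    (ModuleSpace.Class R_Ring kernel kernel_AbelianGroup_class kernel_ModuleSpace_mixin)
    kernel_UniformSpace_mixin.

Definition kernel_NormedModule_mixin : NormedModule.mixin_of R_AbsRing
  (NormedModuleAux.Pack R_AbsRing kernel kernel_NormedModuleAux_class kernel).
Proof.
  assert (E : forall v w, kernel_val (kernel_plus w (kernel_scal (-1) v)) =
    minus (kernel_val w) (kernel_val v)) by (intros; simpl; vec X).
  apply (NormedModule.Mixin R_AbsRing
    (NormedModuleAux.Pack R_AbsRing kernel kernel_NormedModuleAux_class kernel)
    (fun w => norm (kernel_val w)) (norm_factor (V := X))).
  - intros v w; exact (norm_triangle (V := X) _ _).
  - intros k w; exact (norm_scal (V := X) k _).
  - intros v w eps H; apply (norm_compat1 (V := X)); rewrite <- E; exact H.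
  - intros v w eps H; assert (H' := norm_compat2 (V := X) _ _ eps H).
    rewrite <- E in H'; exact H'.
  - intros w H; apply kernel_val_inj; exact (norm_eq_zero (V := X) _ H).
Defined.

(** A limit must be assigned to every filter; [kernel_proj] puts it in the kernel and leaves it
    unchanged when it is already there, as for Cauchy filters. *)
Definition kernel_lim (F : (kernel -> Prop) -> Prop) : kernel :=
  kernel_proj (lim (filtermap kernel_val F)).

Lemma functional_zero_limit (F : (kernel -> Prop) -> Prop) x : ProperFilter F ->
  (forall eps : posreal, F (fun w => ball x eps (kernel_val w))) -> f x = 0.
Proof.
  intros HF Hx; apply (closed_filterlim (F := F) kernel_val (fun x => f x = 0) x).
  - apply filterlim_locally; exact Hx.
  - intros w; exact (proj2_sig w).
  - apply (closed_comp f (fun y => y = 0)); [|apply closed_eq].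
    intros y; exact (linear_cont f y Hf).
Qed.

Definition kernel_CompleteSpace_mixin :
  CompleteSpace.mixin_of (UniformSpace.Pack kernel kernel_UniformSpace_mixin kernel).
Proof.
  apply (CompleteSpace.Mixin (UniformSpace.Pack kernel kernel_UniformSpace_mixin kernel) kernel_lim).
  - intros F HF Hc.
    assert (Hlim : forall eps : posreal, F (fun w => ball
      (lim (filtermap kernel_val F)) eps (kernel_val w))).
    { apply (complete_cauchy (filtermap kernel_val F)).
      - now apply filtermap_proper_filter.
      - intros eps; destruct (Hc eps) as [w Hw]; now exists (kernel_val w). }
    assert (E : kernel_val (kernel_lim F) = lim (filtermap kernel_val F)).
    { simpl; rewrite (functional_zero_limit F _ HF Hlim); vec X. }
    intros eps; generalize (Hlim eps); apply filter_imp; intros w Hw.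
    change (ball (kernel_val (kernel_lim F)) eps (kernel_val w)); now rewrite E.
  - intros F1 F2 H1 H2.
    assert (E : lim (filtermap kernel_val F1) = lim (filtermap kernel_val F2)).
    { apply (eq_close (V := X)), (close_lim (T := X)); intros P; [apply H1|apply H2]. }
    unfold kernel_lim; rewrite E; apply close_refl.
Defined.

Definition kernel_Banach : Banach :=
  CompleteNormedModule.Pack R_AbsRing kernel
    (CompleteNormedModule.Class R_AbsRing kernel
      (NormedModule.Class R_AbsRing kernel kernel_NormedModuleAux_class
        kernel_NormedModule_mixin) kernel_CompleteSpace_mixin) kernel.

Lemma kernel_val_continuous (w : kernel_Banach) : continuous (kernel_val : kernel_Banach -> X) w.
Proof. apply filterlim_locally; intros eps; now exists eps. Qed.

Lemma continuous_to_kernel {U : UniformSpace} (g : U -> kernel_Banach) u :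
  continuous (fun u => kernel_val (g u)) u -> continuous g u.
Proof.
  intros H; apply filterlim_locally; intros eps.
  exact (proj1 (filterlim_locally _ _) H eps).
Qed.

End Kernel.

(** * Folds *)

(** [U y] is the fixed point of [u |-> y + N u]. The bound [norm (u - v) <= 2 * norm (D u - D v)]
    gives both uniqueness and the Lipschitz constant of [U]. *)
Lemma lipschitz_perturbation_inverse {X : Banach} (N : X -> X) :
  (forall u v : X, norm (minus (N u) (N v)) <= / 2 * norm (minus u v)) ->
  exists U : X -> X, (forall y, U y = plus y (N (U y))) /\
    (forall u, U (minus u (N u)) = u) /\
    (forall y z : X, norm (minus (U y) (U z)) <= 2 * norm (minus y z)).
Proof.
  intros HN.
  destruct (choice (fun y u => plus y (N u) = u)) as [U HU].
  { intros y.
    destruct (contraction_fixed_point (Banach_seq_complete X) (fun u => plus y (N u)) (/ 2)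
      (fun _ => True) zero) as (u & _ & Hu); try easy; [lra| |now exists u].
    intros a b; norm_as X (minus (N a) (N b)); apply HN. }
  set (D := fun u => minus u (N u) : X).
  assert (HL : forall u v : X, norm (minus u v) <= 2 * norm (minus (D u) (D v))).
  { intros u v; assert (H := HN u v).
    assert (H2 : norm (minus u v) <= norm (minus (D u) (D v)) + norm (minus (N u) (N v))).
    { eapply Rle_trans; [|apply (norm_triangle (V := X))].
      right; apply (f_equal (norm (V := X))); unfold D; vec X. }
    lra. }
  assert (DU : forall y, D (U y) = y).
  { intros y; unfold D; rewrite <- (HU y) at 1; vec X. }
  exists U; repeat split.
  - intros y; symmetry; apply HU.
  - intros u; fold (D u); apply (norm_minus_0 (V := X)); eapply Rle_trans; [apply HL|].
    rewrite DU; right; rewrite (norm_minus_diag (V := X)); ring.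
  - intros y z; assert (H := HL (U y) (U z)); now rewrite !DU in H.
Qed.

(** In the source, [Psi] straightens the fibres into lines and [tau] rescales the height. In the
    target, [S] recovers [w] from [A w], and subtracting [M w] brings the crest of every fibre to
    height 0. *)
Lemma fold_of_normal_form {X : Banach} (F A S Psi U : X -> X) (f g : X -> R) (phi : X)
  (a1 b1 a2 b2 : R) :
  functional f -> f phi = 1 -> is_linear A -> is_linear S -> A phi = zero -> S phi = zero ->
  (forall x, f (S x) = 0) -> (forall x, f (A x) = 0) ->
  (forall x, A (S x) = minus x (scal (f x) phi)) ->
  (forall x, f x = 0 -> S (A x) = x) ->
  (forall x, continuous Psi x) -> (forall y, continuous U y) ->
  (forall x, U (Psi x) = x) -> (forall y, Psi (U y) = y) ->
  (forall x, continuous F x) -> (forall x, continuous g x) ->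
  (forall y, F (U y) = plus (A y) (scal (g y) phi)) ->
  0 < a1 -> 0 < a2 ->
  (forall y, g y <= a1 * f y + b1) -> (forall y, g y <= b2 - a2 * f y) ->
  (forall w t1 t2 t3, t1 < t2 -> t2 < t3 ->
    g (plus w (scal t2 phi)) <= g (plus w (scal t1 phi)) ->
    g (plus w (scal t3 phi)) < g (plus w (scal t2 phi))) ->
  fold F.
Proof.
  intros Hf Hfphi HA HS HAphi HSphi HfS HfA HAS HSA CPsi CU UPsi PsiU CF Cg HF Ha1 Ha2 Hg1 Hg2 Hu.
  split; [easy|].
  set (W := kernel_Banach f phi Hf Hfphi).
  set (i := kernel_val f : W -> X); set (pr := kernel_proj f phi Hf Hfphi : X -> W).
  assert (Hi : forall w, f (i w) = 0) by (intros w; exact (proj2_sig w)).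
  assert (Hipr : forall x, i (pr x) = minus x (scal (f x) phi)) by easy.
  assert (Hpri : forall w, pr (i w) = w) by apply (kernel_proj_val f phi Hf Hfphi).
  assert (Ci : forall w, continuous i w) by apply (kernel_val_continuous f phi Hf Hfphi).
  assert (Cf : forall x, continuous f x) by (intros x; exact (linear_cont f x Hf)).
  assert (CS : forall x, continuous S x) by (intros x; exact (linear_cont S x HS)).
  assert (Cscal : forall t : R, continuous (fun t : R => scal t phi) t).
  { intros t; exact (linear_cont (fun t : R_NormedModule => scal t phi) t (is_linear_scal_l phi)). }
  assert (Cpr : forall x, continuous pr x).
  { intros x; apply (continuous_to_kernel f phi Hf Hfphi).
    apply (continuous_minus (V := X)); [apply continuous_id|].
    apply (continuous_comp f (fun t => scal t phi)); auto. }
  assert (Cchart : forall q : W * R, continuous (fun q : W * R => plus (i (fst q)) (scal (snd q) phi)) q).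
  { intros [w t]; apply (continuous_plus (V := X)).
    - apply (continuous_comp fst i); [apply continuous_fst|apply Ci].
    - apply (continuous_comp snd (fun t : R => scal t phi)); [apply continuous_snd|apply Cscal]. }
  assert (fchart : forall w t, f (plus (i w) (scal t phi)) = t).
  { intros w t; rewrite (fun_plus f Hf), (fun_scal f Hf), Hi, Hfphi; ring. }
  assert (prchart : forall w t, pr (plus (i w) (scal t phi)) = w).
  { intros w t; apply (kernel_val_inj f); change (i (pr (plus (i w) (scal t phi))) = i w).
    rewrite Hipr, fchart; vec X. }
  destruct (unimodal_family_fold (fun w t => g (plus (i w) (scal t phi))) a1 b1 a2 b2)
    as (M & tau & theta & CM & Ctau & Ctheta & H1 & H2 & H3); auto.
  { intros w t; apply (continuous_comp (fun q : W * R => plus (i (fst q)) (scal (snd q) phi)) g); auto. }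
  { intros w t; generalize (Hg1 (plus (i w) (scal t phi))); now rewrite fchart. }
  { intros w t; generalize (Hg2 (plus (i w) (scal t phi))); now rewrite fchart. }
  { intros w t1 t2 t3; apply (Hu (i w)). }
  assert (Cpair : forall (V : UniformSpace) (a : V -> W) (b : V -> R) x,
    continuous a x -> continuous b x -> continuous (fun x => (a x, b x) : sum_R W) x).
  { intros V a b x Ca Cb; apply (continuous_comp_2 a b (fun w t => (w, t) : sum_R W)); auto.
    apply continuous_ext with (fun q : W * R => q); [now intros []|apply continuous_id]. }
  exists W.
  exists (fun x => (pr (Psi x), tau (pr (Psi x)) (f (Psi x)))).
  exists (fun q => U (plus (i (fst q)) (scal (theta (fst q) (snd q)) phi))).
  exists (fun y => (pr (S y), f y - M (pr (S y)))).
  exists (fun q => plus (A (i (fst q))) (scal (snd q + M (fst q)) phi)).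
  assert (CprPsi : forall x, continuous (fun x => pr (Psi x)) x).
  { intros x; apply (continuous_comp Psi pr); auto. }
  assert (CprS : forall x, continuous (fun x => pr (S x)) x).
  { intros x; apply (continuous_comp S pr); auto. }
  assert (prS : forall w t, pr (S (plus (A (i w)) (scal t phi))) = w).
  { intros w t; rewrite (lin_plus S HS), (lin_scal S HS), HSphi, HSA by apply Hi.
    transitivity (pr (i w)); [f_equal; vec X|apply Hpri]. }
  assert (fA : forall w t, f (plus (A (i w)) (scal t phi)) = t).
  { intros w t; rewrite (fun_plus f Hf), (fun_scal f Hf), HfA, Hfphi; ring. }
  split; [|split].
  - repeat split.
    + intros x; apply Cpair; auto.
      apply (jointly_continuous_comp tau); auto; apply (continuous_comp Psi f); auto.
    + intros [w t]; apply (continuous_comp (fun q : sum_R W => plus (i (fst q))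
        (scal (theta (fst q) (snd q)) phi)) U); auto.
      apply (continuous_comp (fun q : sum_R W => (fst q, theta (fst q) (snd q)) : W * R)
        (fun q : W * R => plus (i (fst q)) (scal (snd q) phi))); [|apply Cchart].
      apply (Cpair _ fst (fun q : W * R => theta (fst q) (snd q))); [apply continuous_fst|apply Ctheta].
    + intros x; cbn [fst snd]; rewrite H2, Hipr.
      transitivity (U (Psi x)); [f_equal; vec X|apply UPsi].
    + intros [w t]; cbn [fst snd]; now rewrite PsiU, prchart, fchart, H1.
  - repeat split.
    + intros y; apply Cpair; auto.
      apply (continuous_R_minus f (fun y => M (pr (S y)))); auto.
      apply (continuous_comp (fun y => pr (S y)) M); auto.
    + intros [w t]; apply (continuous_plus (U := sum_R W) (V := X) (fun q => A (i (fst q)))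
        (fun q => scal (snd q + M (fst q)) phi) (w, t)).
      * apply (continuous_comp (fun q : sum_R W => i (fst q)) A).
        -- apply (continuous_comp fst i); [apply continuous_fst|apply Ci].
        -- exact (linear_cont (V := X) A _ HA).
      * apply (continuous_comp (fun q : sum_R W => snd q + M (fst q)) (fun t : R => scal t phi)); auto.
        apply (continuous_R_plus (U := sum_R W) snd (fun q => M (fst q))); [apply continuous_snd|].
        apply (continuous_comp fst M); [apply continuous_fst|apply CM].
    + intros y; cbn [fst snd]; rewrite Hipr, HfS.
      transitivity (plus (A (S y)) (scal (f y) phi)); [|rewrite HAS; vec X].
      f_equal; [f_equal; vec X|f_equal; ring].
    + intros [w t]; cbn [fst snd]; rewrite prS, fA.
      assert (E : (t : R) + M w - M w = t) by ring; exact (f_equal (pair w) E).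
  - intros w t; cbn [fst snd]; rewrite HF.
    set (th := theta w t).
    assert (E : A (plus (i w) (scal th phi)) = A (i w)).
    { rewrite (lin_plus A HA), (lin_scal A HA), HAphi; vec X. }
    rewrite E, prS, fA.
    assert (Eh : g (plus (i w) (scal th phi)) - M w = - Rabs t).
    { rewrite (H3 w th); unfold th; rewrite H1; ring. }
    exact (f_equal (pair w) Eh).
Qed.

(** * Choice of delta and the normal form of T - P *)

Theorem theorem2 (X : Banach) (K : X -> Prop) (T : X -> X)
  (HK : special_cone K) (HT : M_amenable K T) :
  exists delta : R, 0 < delta /\
    forall (P : X -> X) (DP : X -> X -> X),
      M_compatible K T P DP ->
      (forall u : X, opnorm (shift (DP u) (- spectral_radius T)) < delta) ->
      fold (diff_map T P).
Proof.
  destruct (principal_splitting K T HK HT)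
    as (phi & f & G & Hint & HTphi & Hf & Hfpos & Hfphi & HG & HfT & HTG & HGT).
  assert (HTlin := M_bounded K T HT); destruct (M_b K T HT) as (p & Hp0 & Hp).
  destruct HK as (HKc & _).
  assert (HA : is_linear (T_r T)) by now apply is_linear_shift.
  assert (HAphi : T_r T phi = zero) by (unfold T_r, shift; rewrite HTphi; vec X).
  (* This is Pi G. Removing the [phi] component of [G] makes [S] vanish on [phi] and map into the
     kernel of [f]. *)
  set (S := fun x => minus (G x) (scal (f (G x)) phi) : X).
  assert (HGA : forall x, T_r T x = zero -> x = scal (f x) phi).
  { intros x Hx; apply (minus_eq_zero (V := X)); rewrite <- HGT, Hx; apply (lin_zero G HG). }
  assert (HS : is_linear S).
  { destruct (linear_norm G HG) as (N & HN & HNb), (fun_bound f Hf) as (M & HM & HMb).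
    apply (linear_of_bound (V := X) (W := X)) with (N + M * N * norm phi); unfold S.
    - intros x y; rewrite (lin_plus G HG), (fun_plus f Hf); vec X.
    - intros k x; rewrite (lin_scal G HG), (fun_scal f Hf); vec X.
    - intros x; eapply Rle_trans; [apply (norm_minus_triangle (V := X))|].
      rewrite (norm_scal_eq (V := X)), Rmult_plus_distr_r; apply Rplus_le_compat; [apply HNb|].
      replace (M * N * norm phi * norm x) with (M * (N * norm x) * norm phi) by ring.
      apply Rmult_le_compat_r; [apply (norm_nonneg (V := X))|].
      eapply Rle_trans; [apply HMb|]; apply Rmult_le_compat_l; [lra|apply HNb]. }
  assert (HSphi : S phi = zero).
  { unfold S; rewrite <- (HGA (G phi)); [vec X|]; rewrite HTG, Hfphi; vec X. }
  assert (HfS : forall x, f (S x) = 0).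
  { intros x; unfold S; rewrite (fun_minus f Hf), (fun_scal f Hf), Hfphi; ring. }
  assert (HAS : forall x, T_r T (S x) = minus x (scal (f x) phi)).
  { intros x; unfold S; rewrite (lin_minus _ HA), (lin_scal _ HA), HAphi, HTG; vec X. }
  assert (HSA : forall x, f x = 0 -> S (T_r T x) = x).
  { intros x Hx; unfold S; rewrite HGT, Hx, (fun_minus f Hf), (fun_scal f Hf), Hx; vec X. }
  assert (HW : forall x, f x = 0 -> W_X T x).
  { intros x Hx; exists (G x); rewrite HTG, Hx; vec X. }
  (* [M_compatible] speaks of all splittings, so one has to be exhibited before (M-PR) can be
     used. *)
  assert (Hsplit : M_splitting K T phi f (fun x => minus x (scal (f x) phi)) S).
  { split; auto.
    - intros w (x & ->); apply HfT.
    - intros u; apply HW; rewrite (fun_minus f Hf), (fun_scal f Hf), Hfphi; ring.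
    - intros u; exists (f u); vec X.
    - intros w (x & ->); rewrite HAS, HfT; vec X.
    - intros w (x & ->); apply HSA, HfT. }
  destruct (linear_norm S HS) as (C & HC & HCb).
  destruct (interior_near K phi Hint) as (e & He & Hnear).
  assert (Nphi := norm_nonneg (V := X) phi).
  (* [kappa] bounds the Lipschitz constant of [N], and dividing by the bound [C] of [S] gives delta.
     With 1/2, [U] is 2-Lipschitz; with the other term, [N] composed with [U] moves by less than [e]
     per unit step along [phi], the margin of [phi] in the interior. *)
  set (kappa := Rmin (/ 2) (e / (4 * (norm phi + 1)))).
  assert (Hk0 : 0 < kappa) by (apply Rmin_pos; [lra|apply Rdiv_lt_0_compat; lra]).
  assert (Hk1 : kappa <= / 2) by apply Rmin_l.
  assert (Hk2 : kappa * (2 * norm phi) < e).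
  { apply Rle_lt_trans with (e / (4 * (norm phi + 1)) * (2 * (norm phi + 1))).
    - apply Rmult_le_compat; [lra|lra|apply Rmin_r|lra].
    - replace (e / (4 * (norm phi + 1)) * (2 * (norm phi + 1))) with (e / 2) by (field; lra); lra. }
  exists (kappa / C); split; [now apply Rdiv_lt_0_compat|].
  intros P DP [HC1 _ HPR HPos HNT] Hop.
  destruct (HPR _ _ _ _ Hsplit) as (lm & lp & cm & cp & (Hlm & Hlp) & HPRu).
  set (r := spectral_radius T) in *; set (Pr := shift P (- r)) in *.
  assert (LPr : forall u v : X, norm (minus (Pr u) (Pr v)) <= kappa / C * norm (minus u v)).
  { apply (C1_lipschitz P DP HC1); intros u; apply Rlt_le, Hop. }
  set (N := fun u => S (Pr u)).
  assert (LN : forall u v : X, norm (minus (N u) (N v)) <= kappa * norm (minus u v)).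
  { intros u v; unfold N; rewrite <- (lin_minus S HS).
    eapply Rle_trans; [apply HCb|].
    replace (kappa * norm (minus u v)) with (C * (kappa / C * norm (minus u v))) by (field; lra).
    apply Rmult_le_compat_l; [lra|apply LPr]. }
  destruct (lipschitz_perturbation_inverse N) as (U & HU1 & HU2 & HU3).
  { intros u v; eapply Rle_trans; [apply LN|].
    apply Rmult_le_compat_r; [apply (norm_nonneg (V := X))|easy]. }
  assert (CPr : forall x, continuous Pr x).
  { apply (continuous_of_lipschitz (V := X) (W := X) Pr (kappa / C)); exact LPr. }
  assert (CU : forall x, continuous U x).
  { apply (continuous_of_lipschitz (V := X) (W := X) U 2); exact HU3. }
  assert (HF : forall u, diff_map T P u = plus (T_r T (minus u (N u))) (scal (- f (Pr u)) phi)).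
  { intros u; unfold N; rewrite (lin_minus _ HA), HAS; unfold diff_map, T_r, Pr, shift; fold r; vec X. }
  (* This turns (M-PR) at [U y] into affine bounds in the height [f y], with slopes [r - lm] and
     [lp - r]. *)
  assert (HfU : forall y, f (U y) = f y).
  { intros y; rewrite (HU1 y), (fun_plus f Hf); unfold N; rewrite HfS; ring. }
  assert (HFU : forall y, diff_map T P (U y) = plus (T_r T y) (scal (- f (Pr (U y))) phi)).
  { intros y; rewrite HF; do 2 f_equal; rewrite (HU1 y) at 1; vec X. }
  apply (fold_of_normal_form (diff_map T P) (T_r T) S (fun u => minus u (N u)) U f
    (fun y => - f (Pr (U y))) phi (r - lm) (- cm) (lp - r) (- cp)); auto; try lra.
  - intros x; apply (continuous_minus (V := X)); [apply continuous_id|].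
    apply (continuous_comp Pr S); [apply CPr|exact (linear_cont S _ HS)].
  - intros y; rewrite (HU1 y) at 1; vec X.
  - intros x; apply (continuous_ext (fun u => minus (T_r T u) (Pr u))).
    + intros u; unfold diff_map, T_r, Pr, shift; fold r; vec X.
    + apply (continuous_minus (V := X)); [exact (linear_cont _ _ HA)|apply CPr].
  - intros y; apply (continuous_comp (fun y => f (Pr (U y))) Ropp).
    + apply (continuous_comp (fun y => Pr (U y)) f); [|exact (linear_cont f _ Hf)].
      now apply (continuous_comp U Pr).
    + apply (continuous_opp (V := R_NormedModule) (fun x => x)), continuous_id.
  - intros y; generalize (proj1 (HPRu (U y))); rewrite HfU; lra.
  - intros y; generalize (proj2 (HPRu (U y))); rewrite HfU; lra.
  - intros w t1 t2 t3 H12 H23 Hle.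
    assert (Hchord : forall s t, s < t ->
      interior K (minus (U (plus w (scal t phi))) (U (plus w (scal s phi))))).
    { intros s t Hst; set (a := U (plus w (scal s phi))); set (b := U (plus w (scal t phi))).
      (* Up to the factor [t - s], the chord is [phi] plus an increment of [N] that stays inside the
         ball of radius [e]. *)
      assert (E : minus b a = scal (t - s) (plus phi (scal (/ (t - s)) (minus (N b) (N a))))).
      { transitivity (plus (scal (t - s) phi) (minus (N b) (N a))); [|vec_eq X; field; lra].
        unfold b at 1, a at 1; rewrite (HU1 (plus w (scal t phi))), (HU1 (plus w (scal s phi))).
        fold a b; vec X. }
      rewrite E; apply (interior_scal K HKc); [lra|]; apply Hnear.
      rewrite (norm_scal_eq (V := X)), Rabs_pos_eq by (apply Rlt_le, Rinv_0_lt_compat; lra).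
      assert (Hab : norm (minus b a) <= 2 * ((t - s) * norm phi)).
      { eapply Rle_trans; [apply HU3|]; norm_as X (scal (t - s) phi).
        rewrite (norm_scal_eq (V := X)), Rabs_pos_eq by lra; lra. }
      apply Rmult_lt_reg_l with (t - s); [lra|]; rewrite <- Rmult_assoc, Rinv_r, Rmult_1_l by lra.
      eapply Rle_lt_trans; [apply LN|].
      apply Rle_lt_trans with (kappa * (2 * ((t - s) * norm phi))).
      - apply Rmult_le_compat_l; lra.
      - replace (kappa * (2 * ((t - s) * norm phi))) with ((t - s) * (kappa * (2 * norm phi))) by ring.
        apply Rmult_lt_compat_l; lra. }
    assert (Hdiff : forall s t, minus (diff_map T P (U (plus w (scal t phi))))
      (diff_map T P (U (plus w (scal s phi)))) =
      scal (- f (Pr (U (plus w (scal t phi)))) - - f (Pr (U (plus w (scal s phi))))) phi).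
    { intros s t; rewrite !HFU, !(lin_plus _ HA), !(lin_scal _ HA), HAphi; vec X. }
    set (u1 := U (plus w (scal t1 phi))) in *.
    set (u2 := U (plus w (scal t2 phi))) in *.
    set (u3 := U (plus w (scal t3 phi))) in *.
    assert (E2 : plus u1 (minus u2 u1) = u2) by vec X.
    assert (E3 : plus u2 (minus u3 u2) = u3) by vec X.
    apply Rminus_lt.
    apply (chord_monotone K T P DP p phi f u1 (minus u2 u1) (minus u3 u2)
      (- f (Pr u2) - - f (Pr u1))); auto.
    + now apply (interior_in K).
    + apply (Hchord t1 t2 H12).
    + apply (Hchord t2 t3 H23).
    + rewrite E2; apply Hdiff.
    + rewrite E2, E3; apply Hdiff.
    + lra.
Qed.
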